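(* There exist a uniformly continuous, compactly supported, weakly divergence-free velocity field $u\in C_c([0,\infty)\times\mathbb{R}^2;\mathbb{R}^2)$ and a time-dependent locally finite Borel measure $\omega=\omega(t)$ on $\mathbb{R}^2$ such that $\omega$ is weakly advected by $u$ on $[0,T]$ for every $T>0$, $\mathrm{supp}\,\omega(0)=\{(0,0)\}$, and $\dim_H\mathrm{supp}\,\omega(t)=2$ for all $t>0$. Moreover, $u$ is locally Lipschitz on $[0,\infty)\times(\mathbb{R}^2\setminus\{(0,0)\})$.
   Context: Weak advection (2D): Let $T>0$ and $u\in C([0,T]\times\mathbb{R}^2;\mathbb{R}^2)$ be continuous and weakly divergence free. A family $\mu(t)$, $t\in[0,T]$, of locally finite Borel measures on $\mathbb{R}^2$ is weakly advected by $u$ on $[0,T]$ if for every $\phi\in C_c^\infty([0,T]\times\mathbb{R}^2)$ $$\int_0^T\!\!\int\partial_t\phi(t,x)\,d\mu(t)(x)\,dt-\int\phi(T,x)\,d\mu(T)(x)+\int\phi(0,x)\,d\mu(0)(x)+\int_0^T\!\!\int (u\cdot\nabla)\phi(t,x)\,d\mu(t)(x)\,dt=0.$$ $\dim_H$ denotes Hausdorff dimension. *)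

(* Defs.v *)
From mathcomp Require Import all_boot all_order all_algebra.
From mathcomp Require Import all_classical all_reals all_analysis.
Import Order.TTheory GRing.Theory Num.Theory numFieldNormedType.Exports.
Set Implicit Arguments. Unset Strict Implicit. Unset Printing Implicit Defensive.
Local Open Scope ring_scope.
Local Open Scope classical_set_scope.

Section Defs.
Variable R : realType.

Definition eucl (x y : R * R) : R :=
  Num.sqrt ((x.1 - y.1) ^+ 2 + (x.2 - y.2) ^+ 2).
Definition enorm (x : R * R) : R := Num.sqrt (x.1 ^+ 2 + x.2 ^+ 2).

Fixpoint Ck {V : normedModType R} (n : nat) (f : V -> R) : Prop :=
  match n with
  | 0 => continuous f
  | n'.+1 => continuous f /\
      forall v : V, (forall x, derivable f x v) /\ Ck n' ('D_v f)
  end.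
Definition smooth {V : normedModType R} (f : V -> R) := forall n, Ck n f.
Definition bounded_support {V : normedModType R} (f : V -> R) :=
  exists M : R, forall x : V, M < `|x| -> f x = 0.
Definition test_fun {V : normedModType R} (f : V -> R) :=
  smooth f /\ bounded_support f.

Definition leb2 := (@lebesgue_measure R \x @lebesgue_measure R)%E.

Definition weakly_div_free (u : R -> R * R -> R * R) :=
  forall t : R, 0 <= t -> forall psi : R * R -> R, test_fun psi ->
    (\int[leb2]_x ((u t x).1 * 'D_((1 : R), (0 : R)) psi x
                    + (u t x).2 * 'D_((0 : R), (1 : R)) psi x)%:E = 0)%E.

(* Weak advection on [0,T]; test functions are (restrictions to [0,T]xR^2 of)
   C_c^infty functions on R x R^2. *)
Definition weakly_advected (u : R -> R * R -> R * R)
    (mu : R -> {measure set (R * R) -> \bar R}) (T : R) :=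
  forall phi : R * (R * R) -> R, test_fun phi ->
   (\int[lebesgue_measure]_(t in [set t : R | (0 <= t <= T)%R])
       (\int[mu t]_x ('D_((1 : R), ((0 : R), (0 : R))) phi (t, x))%:E)
    - \int[mu T]_x (phi (T, x))%:E
    + \int[mu 0%R]_x (phi (0%R, x))%:E
    + \int[lebesgue_measure]_(t in [set t : R | (0 <= t <= T)%R])
       (\int[mu t]_x ((u t x).1 * 'D_((0 : R), ((1 : R), (0 : R))) phi (t, x)
                    + (u t x).2 * 'D_((0 : R), ((0 : R), (1 : R))) phi (t, x))%:E)
    = 0)%E.

Definition locally_finite (mu : {measure set (R * R) -> \bar R}) :=
  forall x : R * R, exists2 r : R, 0 < r & (mu (ball x r) < +oo)%E.

Definition msupp (mu : {measure set (R * R) -> \bar R}) : set (R * R) :=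
  [set x | forall r : R, 0 < r -> (0 < mu (ball x r))%E].

Definition ediam (U : set (R * R)) : \bar R :=
  ereal_sup [set e | exists x y, U x /\ U y /\ e = (eucl x y)%:E].
Definition hcost (s : R) (U : set (R * R)) : \bar R :=
  if pselect (U = set0) then 0%E else ((fine (ediam U)) `^ s)%:E.
Definition hausdorff_delta (s delta : R) (A : set (R * R)) : \bar R :=
  ereal_inf [set (\sum_(i <oo) hcost s (U i))%E | U in
    [set U : nat -> set (R * R) |
       A `<=` \bigcup_i U i /\ forall i, (ediam (U i) <= delta%:E)%E]].
Definition hausdorff (s : R) (A : set (R * R)) : \bar R :=
  ereal_sup [set hausdorff_delta s d A | d in [set d : R | 0 < d]].
Definition hdim (A : set (R * R)) : \bar R :=
  ereal_inf [set s%:E | s in [set s : R | 0 <= s /\ hausdorff s A = 0%E]].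

End Defs.

(* Main.v *)
Require Import Defs.
From mathcomp Require Import all_boot all_order all_algebra.
From mathcomp Require Import all_classical all_reals all_analysis.
From mathcomp Require Import measurable_realfun ring lra.
Import Order.TTheory GRing.Theory Num.Theory numFieldNormedType.Exports.
Set Implicit Arguments.
Unset Strict Implicit.
Unset Printing Implicit Defensive.
Local Open Scope ring_scope.
Local Open Scope classical_set_scope.

(** The field is self-similar in time: [u(t, x) = lam'(t) U(x / lam(t))] for a
    [C^{1,1}] step [lam] from 0 to 1, so that [t |-> lam(t) k] is a trajectory
    starting at the origin whenever [U k = k].  It then suffices to find a
    divergence-free, compactly supported [U], locally Lipschitz away from 0, which
    fixes a countable set of points [k] whose closure has dimension 2: the measure
    [omega(t)] is a sum of weighted Dirac masses at the points [lam(t) k].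

    A divergence-free bump field can be made constant, equal to its center [c], on a
    concentric square.  Four such bumps with centers [(+-1/2, +-1/2)], corrected
    inside their plateaux by copies of the field itself scaled by [sigma < 1/2],
    give a Lipschitz field that is the identity on a Cantor set of dimension
    [log 4 / log (1/sigma) < 2].  The Lipschitz constant blows up as [sigma] tends
    to [1/2]; [U] is a sum of disjointly supported copies with [sigma_n -> 1/2]
    accumulating at the origin only. *)


(** The atoms leave the origin although [u(t, 0) = 0], so [u] cannot be Lipschitz there; everything
    is arranged so that this is the only irregularity. Since [lam] is about [2 t^2] near time 0, its
    derivative tends to 0, and the bounded [U] gives [u -> 0] as [t -> 0]; for [t] bounded below,
    the linear bound [|U x| <= C |x|] makes [u] small near the origin. Near a point other than the
    origin, [u(t, .)] vanishes until [2 lam(t)] reaches that point, so the factor [1 / lam(t)] does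
    no harm there. A single Cantor set is not enough: dimension 2 would force [sigma = 1/2] and
    leave no room between plateaux. Supports being closed, countably many atoms accumulating on the
    Cantor sets already have them in their support, so no measure on a Cantor set is built. The
    lower bound on the dimension comes instead from Lebesgue measure on [[0, 1)], carried over by
    base-4 digits that name the bumps. *)

Lemma is_derive_eps (R : realType) (f : R -> R) (x l : R) :
  (forall e, 0 < e -> exists2 d, 0 < d &
     forall h, `|h| < d -> `|f (x + h) - f x - h * l| <= e * `|h|) ->
  is_derive x 1 f l.
Proof.
move=> H.
have cv : h^-1 *: (f (h *: (1 : R) + x) - f x) @[h --> 0^'] --> l.
  apply/cvgrPdist_le => e e0; have [d d0 hd] := H e e0; near=> h.
  have h0 : h != 0 by near: h; exact: nbhs_dnbhs_neq.
  have hC : `|h| < d by near: h; exact: dnbhs0_lt.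
  have -> : l - h^-1 *: (f (h *: (1 : R) + x) - f x) = - (h^-1 * (f (x + h) - f x - h * l)).
    have -> : h *: (1 : R) = h by exact: mulr1.
    by rewrite /GRing.scale /= (addrC h x); field.
  have hn0 : 0 < `|h| by rewrite normr_gt0.
  by rewrite normrN normrM normfV ler_pdivrMl// [leRHS]mulrC; exact: hd.
split; first by apply/cvg_ex; exists l.
exact: cvg_lim cv.
Unshelve. all: by end_near.
Qed.

(** * The quadratic time step, and bounded Lipschitz functions of one variable *)

Section smooth_step.
Variable R : realType.
Implicit Types (t s x y : R).

Definition pos t := Num.max t 0.

Lemma pos_cases t : (pos t = 0 /\ t <= 0) \/ (pos t = t /\ 0 <= t).
Proof. by rewrite /pos; case: (lerP t 0) => h; [left|right; rewrite ltW]. Qed.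

(** The spline with second derivative 4 on (0, 1/2), -4 on (1/2, 1) and 0 elsewhere, written in
    truncated powers so that each fact about it is a case analysis on three signs. *)
Definition lam t : R :=
  2 * pos t ^+ 2 - 4 * pos (t - 1/2) ^+ 2 + 2 * pos (t - 1) ^+ 2.
Definition dlam t : R := 4 * pos t - 8 * pos (t - 1/2) + 4 * pos (t - 1).

Ltac case_pos t :=
  case: (pos_cases t) => -[-> ?]; case: (pos_cases (t - 1/2)) => -[-> ?];
  case: (pos_cases (t - 1)) => -[-> ?].

Lemma lam_le0 t : t <= 0 -> lam t = 0.
Proof. by rewrite /lam; case_pos t => *; nra. Qed.

Lemma lam_ge1 t : 1 <= t -> lam t = 1.
Proof. by rewrite /lam; case_pos t => *; nra. Qed.

Lemma dlam_le0 t : t <= 0 -> dlam t = 0.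
Proof. by rewrite /dlam; case_pos t => *; lra. Qed.

Lemma dlam_ge1 t : 1 <= t -> dlam t = 0.
Proof. by rewrite /dlam; case_pos t => *; lra. Qed.

Lemma lam_gt0 t : 0 < t -> 0 < lam t.
Proof.
move=> t0; rewrite /lam; case_pos t; try nra.
(* Between 1/2 and 1, [lam t - t] is twice this product. *)
all: by have : 0 <= (t - 1/2) * (1 - t) by [apply: mulr_ge0; lra]; nra.
Qed.

Lemma lam_ge0 t : 0 <= lam t.
Proof.
by case: (lerP t 0) => [/lam_le0 ->//|/lam_gt0/ltW].
Qed.

Lemma lam_le1 t : lam t <= 1.
Proof. by rewrite /lam; case_pos t => *; nra. Qed.

Lemma dlam_ge0 t : 0 <= dlam t.
Proof. by rewrite /dlam; case_pos t => *; nra. Qed.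

Lemma dlam_le2 t : dlam t <= 2.
Proof. by rewrite /dlam; case_pos t => *; nra. Qed.

Lemma dlam_le t : 0 <= t -> dlam t <= 4 * t.
Proof. by rewrite /dlam; case_pos t => *; nra. Qed.

Lemma norm_pos_sub t s : `|pos t - pos s| <= `|t - s|.
Proof.
have h1 := ler_norm (t - s); have h2 := ler_norm (- (t - s)).
rewrite normrN in h2; have h3 := normr_ge0 (t - s).
case: (pos_cases t) => -[-> ?]; case: (pos_cases s) => -[-> ?];
by rewrite ler_norml; apply/andP; split; lra.
Qed.

Lemma dlam_lip t s : `|dlam t - dlam s| <= 16 * `|t - s|.
Proof.
have h1 := norm_pos_sub t s.
have h2 := norm_pos_sub (t - 1/2) (s - 1/2).
have h3 := norm_pos_sub (t - 1) (s - 1).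
move: h2 h3; have -> : t - 1/2 - (s - 1/2) = t - s by lra.
have -> : t - 1 - (s - 1) = t - s by lra.
move: h1; rewrite /dlam !ler_norml => /andP[? ?] /andP[? ?] /andP[? ?].
by apply/andP; split; lra.
Qed.

Lemma is_derive_quadratic (f : R -> R) (x l C : R) :
  (forall h, `|f (x + h) - f x - h * l| <= C * h ^+ 2) -> is_derive x 1 f l.
Proof.
move=> H; apply: is_derive_eps => e e0.
have Cle := ler_norm C; have C0 := normr_ge0 C.
exists (e / (`|C| + 1)) => [|h]; first by rewrite divr_gt0//; lra.
rewrite ltr_pdivlMr; last lra.
move=> hC; apply: (le_trans (H h)).
have -> : h ^+ 2 = `|h| * `|h| by rewrite -normrM -expr2 ger0_norm ?sqr_ge0.
by have := normr_ge0 h; nra.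
Qed.

(** The first-order remainder of the squared positive part lies between 0 and the squared increment;
    8 is the sum of the coefficients 2, 4, 2. *)
Lemma lam_quadratic (t h : R) : `|lam (t + h) - lam t - h * dlam t| <= 8 * h ^+ 2.
Proof.
have key (s c : R) : 0 <= pos (s + c) ^+ 2 - pos s ^+ 2 - 2 * c * pos s <= c ^+ 2.
  by case: (pos_cases (s + c)) => -[-> ?]; case: (pos_cases s) => -[-> ?]; apply/andP; split; nra.
have := key t h; have := key (t - 1/2) h; have := key (t - 1) h.
have -> : t - 1/2 + h = t + h - 1/2 by lra.
have -> : t - 1 + h = t + h - 1 by lra.
rewrite /lam /dlam => /andP[? ?] /andP[? ?] /andP[? ?].
by rewrite ler_norml; apply/andP; split; nra.
Qed.

Lemma is_derive_lam t : is_derive t 1 lam (dlam t).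
Proof. by apply: (@is_derive_quadratic _ _ _ 8) => h; exact: lam_quadratic. Qed.

Lemma lipschitz_is_derive (f df : R -> R) (M : R) :
  (forall x, is_derive x 1 f (df x)) -> (forall x, `|df x| <= M) ->
  forall x y, `|f x - f y| <= M * `|x - y|.
Proof.
move=> fdf dfM.
have main x y : x < y -> `|f y - f x| <= M * `|y - x|.
  move=> xy.
  have cf : {within `[x, y], continuous f}.
    by apply: derivable_within_continuous => z _; have := fdf z => -[].
  by have [c _ ->] := MVT xy (fun z _ => fdf z) cf; rewrite normrM ler_wpM2r.
move=> x y; case: (ltgtP x y) => [xy|yx|->].
- by rewrite distrC (distrC x); exact: main.
- exact: main.
- by rewrite !subrr normr0 mulr0.
Qed.

Lemma lam_lip t s : `|lam t - lam s| <= 2 * `|t - s|.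
Proof.
apply: (@lipschitz_is_derive _ dlam) => x; first exact: is_derive_lam.
by rewrite ger0_norm ?dlam_ge0 ?dlam_le2.
Qed.

Lemma continuous_lipschitz (f : R -> R) (M : R) :
  (forall x y, `|f x - f y| <= M * `|x - y|) -> continuous f.
Proof.
move=> H x; apply/cvgrPdist_le => e e0; near=> y.
apply: (le_trans (H x y)).
have hC : `|x - y| <= e / (`|M| + 1).
  near: y; apply: cvgr_dist_le => //; rewrite divr_gt0//; have := normr_ge0 M; lra.
have Cle := ler_norm M.
have C0 := normr_ge0 M.
have := normr_ge0 (x - y).
move: hC; rewrite ler_pdivlMr; last lra.
by move=> hC; nra.
Unshelve. all: by end_near.
Qed.

(* Bounded Lipschitz functions: unlike Lipschitz functions, they are closed under products. *)
Definition blip (f : R -> R) := exists M : R,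
  (forall x, `|f x| <= M) /\ (forall x y, `|f x - f y| <= M * `|x - y|).

Lemma blip_pos f : blip f -> exists M : R, 0 <= M /\
  (forall x, `|f x| <= M) /\ (forall x y, `|f x - f y| <= M * `|x - y|).
Proof.
case=> M [h1 h2]; exists M; split => //; exact: le_trans (normr_ge0 _) (h1 0).
Qed.

Lemma blip_add f g : blip f -> blip g -> blip (fun x => f x + g x).
Proof.
move=> [M [h1 h2]] [N [h3 h4]]; exists (M + N); split=> [x|x y].
  by apply: (le_trans (ler_normD _ _)); exact: lerD.
have -> : f x + g x - (f y + g y) = (f x - f y) + (g x - g y) by lra.
by apply: (le_trans (ler_normD _ _)); rewrite mulrDl; exact: lerD.
Qed.

Lemma blip_mul f g : blip f -> blip g -> blip (fun x => f x * g x).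
Proof.
move=> /blip_pos[M [M0 [h1 h2]]] /blip_pos[N [N0 [h3 h4]]].
exists (2 * M * N); split=> [x|x y].
  rewrite normrM; apply: (@le_trans _ _ (M * N)); first exact: ler_pM.
  by have := mulr_ge0 M0 N0; nra.
have -> : f x * g x - f y * g y = (f x - f y) * g x + f y * (g x - g y) by ring.
apply: (le_trans (ler_normD _ _)); rewrite !normrM.
have : `|f x - f y| * `|g x| <= (M * `|x - y|) * N by exact: ler_pM.
have : `|f y| * `|g x - g y| <= M * (N * `|x - y|) by exact: ler_pM.
by nra.
Qed.

Lemma blip_cst c : blip (fun=> c).
Proof.
by exists `|c|; split=> [x|x y]//; rewrite subrr normr0 mulr_ge0.
Qed.

Lemma blip_affine f a b : blip f -> blip (fun x => f (a * x + b)).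
Proof.
move=> /blip_pos[M [M0 [h1 h2]]]; exists (M * (`|a| + 1)); split=> [x|x y].
  by apply: (le_trans (h1 _)); have := mulr_ge0 M0 (normr_ge0 a); nra.
apply: (le_trans (h2 _ _)).
have -> : a * x + b - (a * y + b) = a * (x - y) by ring.
rewrite normrM -mulrA ler_wpM2l// ler_wpM2r//; lra.
Qed.

Lemma blip_lam : blip lam.
Proof.
exists 2; split; last exact: lam_lip.
by move=> x; rewrite ger0_norm ?lam_ge0//; have := lam_le1 x; lra.
Qed.

Lemma blip_dlam : blip dlam.
Proof.
exists 16; split; last exact: dlam_lip.
by move=> x; rewrite ger0_norm ?dlam_ge0//; have := dlam_le2 x; lra.
Qed.

Definition clampid t : R := pos (t + 1) - pos (t - 1) - 1.

Lemma blip_clampid : blip clampid.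
Proof.
exists 2; rewrite /clampid; split=> [x|x y].
  rewrite ler_norml; case: (pos_cases (x + 1)) => -[-> ?];
  by case: (pos_cases (x - 1)) => -[-> ?]; apply/andP; split; lra.
have h1 := norm_pos_sub (x + 1) (y + 1).
have h2 := norm_pos_sub (x - 1) (y - 1).
move: h1 h2; have -> : x + 1 - (y + 1) = x - y by lra.
have -> : x - 1 - (y - 1) = x - y by lra.
rewrite !ler_norml => /andP[? ?] /andP[? ?].
by apply/andP; split; lra.
Qed.

Lemma clampidE t : `|t| <= 1 -> clampid t = t.
Proof.
rewrite ler_norml /clampid => /andP[? ?].
case: (pos_cases (t + 1)) => -[-> ?];
by case: (pos_cases (t - 1)) => -[-> ?]; lra.
Qed.

End smooth_step.

(** * The max norm of the plane *)

Section plane_norm.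
Variable R : realType.
Implicit Types x y : R * R.

Lemma plane_norm_le x (c : R) : (`|x| <= c) = (`|x.1| <= c) && (`|x.2| <= c).
Proof. by rewrite prod_normE ge_max. Qed.

Lemma plane_norm_lt x (c : R) : (`|x| < c) = (`|x.1| < c) && (`|x.2| < c).
Proof. by rewrite prod_normE gt_max. Qed.

Lemma plane_norm_ge x (c : R) : (c <= `|x|) = (c <= `|x.1|) || (c <= `|x.2|).
Proof. by rewrite prod_normE le_max. Qed.

Lemma plane_eq x y : x.1 = y.1 -> x.2 = y.2 -> x = y.
Proof. by case: x y => [? ?] [? ?] /= -> ->. Qed.

End plane_norm.

Lemma is_derive_mul (R : realType) (f g : R -> R) (x df dg : R) :
  is_derive x 1 f df -> is_derive x 1 g dg ->
  is_derive x 1 (fun t => f t * g t) (df * g x + f x * dg).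
Proof.
move=> hf hg; have := is_deriveM hf hg; congr is_derive.
by rewrite /GRing.scale /= addrC (mulrC (g x)).
Qed.

(** * Divergence-free bumps with a constant plateau *)

Section cutoff.
Variables (R : realType) (tau : R).
Hypotheses (tau0 : 0 < tau) (tau_half : tau < 1/2).

Let a : R := (1/2 - tau)^-1.

(** The factor [a] stretches each transition layer, of width [1/2 - tau], onto the unit layer of
    [lam]. *)
Definition cutoff (s : R) : R := lam (a * (1/2 - s)) * lam (a * (1/2 + s)).
Definition dcutoff (s : R) : R :=
  a * (lam (a * (1/2 - s)) * dlam (a * (1/2 + s))
       - dlam (a * (1/2 - s)) * lam (a * (1/2 + s))).
Definition lincut (s : R) : R := s * cutoff s.
Definition dlincut (s : R) : R := cutoff s + s * dcutoff s.

Let a_gt0 : 0 < a. Proof. by rewrite /a invr_gt0; have := tau_half; lra. Qed.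

Let a_ge1 (b : R) : 1/2 - tau <= b -> 1 <= a * b.
Proof. by move=> h; rewrite /a ler_pdivlMl ?mulr1 //; have := tau_half; lra. Qed.

Let a_le0 (b : R) : b <= 0 -> a * b <= 0.
Proof. by move=> h; rewrite pmulr_rle0. Qed.

Lemma cut_in (s : R) : `|s| <= tau -> cutoff s = 1.
Proof.
rewrite ler_norml => /andP[? ?]; rewrite /cutoff !lam_ge1 ?mulr1//;
by apply: a_ge1; lra.
Qed.

Lemma dcut_in (s : R) : `|s| <= tau -> dcutoff s = 0.
Proof.
rewrite ler_norml => /andP[? ?]; rewrite /dcutoff !dlam_ge1 ?mulr0 ?mul0r ?subr0 ?mulr0//;
by apply: a_ge1; lra.
Qed.

Let half_cases (s : R) : 1/2 <= `|s| -> 1/2 - s <= 0 \/ 1/2 + s <= 0.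
Proof. by rewrite ler_normr => /orP[]?; [left|right]; lra. Qed.

Lemma cut_out (s : R) : 1/2 <= `|s| -> cutoff s = 0.
Proof.
by move=> /half_cases[] /a_le0 h; rewrite /cutoff (lam_le0 h) ?mul0r ?mulr0.
Qed.

Lemma dcut_out (s : R) : 1/2 <= `|s| -> dcutoff s = 0.
Proof.
by move=> /half_cases[] /a_le0 h;
 rewrite /dcutoff (lam_le0 h) (dlam_le0 h) ?mul0r ?mulr0 ?subr0 ?mulr0.
Qed.

Lemma lin_in (s : R) : `|s| <= tau -> lincut s = s.
Proof. by move=> h; rewrite /lincut cut_in// mulr1. Qed.

Lemma dlin_in (s : R) : `|s| <= tau -> dlincut s = 1.
Proof. by move=> h; rewrite /dlincut cut_in// dcut_in// mulr0 addr0. Qed.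

Lemma lin_out (s : R) : 1/2 <= `|s| -> lincut s = 0.
Proof. by move=> h; rewrite /lincut cut_out// mulr0. Qed.

Lemma dlin_out (s : R) : 1/2 <= `|s| -> dlincut s = 0.
Proof. by move=> h; rewrite /dlincut cut_out// dcut_out// mulr0 addr0. Qed.

Lemma is_derive_cut (s : R) : is_derive s 1 cutoff (dcutoff s).
Proof.
have h1 : is_derive s 1 (fun s => a * (1/2 - s) : R) (- a).
  by apply: (@is_derive_quadratic _ _ _ _ 0) => h; rewrite mul0r normr_le0; apply/eqP; ring.
have h2 : is_derive s 1 (fun s => a * (1/2 + s) : R) a.
  by apply: (@is_derive_quadratic _ _ _ _ 0) => h; rewrite mul0r normr_le0; apply/eqP; ring.
have h3 := @is_derive1_comp R (@lam R) (fun s => a * (1/2 - s)) _ _ _ (is_derive_lam (a * (1/2 - s))) h1.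
have h4 := @is_derive1_comp R (@lam R) (fun s => a * (1/2 + s)) _ _ _ (is_derive_lam (a * (1/2 + s))) h2.
have := is_derive_mul h3 h4.
by congr is_derive; rewrite /dcutoff /=; ring.
Qed.

Lemma is_derive_lin (s : R) : is_derive s 1 lincut (dlincut s).
Proof.
have := is_derive_mul (is_derive_id s (1 : R)) (is_derive_cut s).
by congr is_derive; rewrite /dlincut /= mul1r.
Qed.

Let blip_minus (f : R -> R) : blip f -> blip (fun s => f (a * (1/2 - s))).
Proof.
move=> /(blip_affine (-a) (a * (1/2))); congr blip; apply/funext => s; congr f; ring.
Qed.

Let blip_plus (f : R -> R) : blip f -> blip (fun s => f (a * (1/2 + s))).
Proof.
move=> /(blip_affine a (a * (1/2))); congr blip; apply/funext => s; congr f; ring.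
Qed.

Lemma blip_cut : blip cutoff.
Proof.
by apply: blip_mul; [apply: blip_minus|apply: blip_plus]; exact: blip_lam.
Qed.

Lemma blip_dcut : blip dcutoff.
Proof.
apply: blip_mul; first exact: blip_cst.
apply: blip_add; first by apply: blip_mul; [apply: blip_minus; exact: blip_lam|apply: blip_plus; exact: blip_dlam].
have -> : (fun s => - (dlam (a * (1/2 - s)) * lam (a * (1/2 + s)))) =
   (fun s => (-1) * (dlam (a * (1/2 - s)) * lam (a * (1/2 + s)))).
  by apply/funext => s; rewrite mulN1r.
apply: blip_mul; first exact: blip_cst.
by apply: blip_mul; [apply: blip_minus; exact: blip_dlam|apply: blip_plus; exact: blip_lam].
Qed.

(* Multiplication by s is not bounded, but it agrees with the truncated identity on the support of f. *)
Let blip_mulid (f : R -> R) : (forall s, 1/2 <= `|s| -> f s = 0) -> blip f ->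
  blip (fun s => s * f s).
Proof.
move=> f0 bf.
have -> : (fun s => s * f s) = (fun s => clampid s * f s).
  apply/funext => s; have [h|h] := lerP `|s| 1; first by rewrite clampidE.
  by rewrite f0 ?mulr0//; lra.
by apply: blip_mul => //; exact: blip_clampid.
Qed.

Lemma blip_lin : blip lincut.
Proof. by apply: blip_mulid; [exact: cut_out|exact: blip_cut]. Qed.

Lemma blip_dlin : blip dlincut.
Proof.
apply: blip_add; first exact: blip_cut.
by apply: blip_mulid; [exact: dcut_out|exact: blip_dcut].
Qed.

(* The divergence-free field with stream function c1 cutoff(z1) lincut(z2) - c2 lincut(z1) cutoff(z2):
   a compactly supported field equal to the constant c near 0. *)
Definition plateau (c z : R * R) : R * R :=
  (c.1 * (cutoff z.1 * dlincut z.2) - c.2 * (lincut z.1 * dcutoff z.2),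
   c.2 * (dlincut z.1 * cutoff z.2) - c.1 * (dcutoff z.1 * lincut z.2)).

Lemma plateau_in c z : `|z| <= tau -> plateau c z = c.
Proof.
rewrite plane_norm_le => /andP[h1 h2]; apply: plane_eq => /=;
by rewrite !cut_in// !dcut_in// !dlin_in// ?mulr0 ?mul0r ?mulr0 ?mulr1 subr0.
Qed.

Lemma plateau_out c z : 1/2 <= `|z| -> plateau c z = 0.
Proof.
rewrite plane_norm_ge => /orP[] h; apply: plane_eq => /=;
by rewrite ?(cut_out h) ?(dcut_out h) ?(lin_out h) ?(dlin_out h) ?mul0r ?mulr0 ?subrr ?mulr0 ?subrr.
Qed.

Let blip2 (f g : R -> R) : blip f -> blip g -> exists M : R, 0 <= M /\
  (forall z : R * R, `|f z.1 * g z.2| <= M) /\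
  (forall z w : R * R, `|f z.1 * g z.2 - f w.1 * g w.2| <= M * `|z - w|).
Proof.
move=> /blip_pos[M [M0 [h1 h2]]] /blip_pos[N [N0 [h3 h4]]].
have MN0 := mulr_ge0 M0 N0.
exists (2 * M * N); split; [nra|split] => [z|z w].
  by rewrite normrM; apply: (@le_trans _ _ (M * N)); [exact: ler_pM|nra].
have -> : f z.1 * g z.2 - f w.1 * g w.2 =
  (f z.1 - f w.1) * g z.2 + f w.1 * (g z.2 - g w.2) by ring.
have := lexx `|z - w|; rewrite {1}plane_norm_le /= => /andP[l1 l2].
apply: (le_trans (ler_normD _ _)); rewrite !normrM.
have e1 : `|f z.1 - f w.1| <= M * `|z - w|.
  by apply: (le_trans (h2 _ _)); rewrite ler_wpM2l.
have e2 : `|g z.2 - g w.2| <= N * `|z - w|.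
  by apply: (le_trans (h4 _ _)); rewrite ler_wpM2l.
have : `|f z.1 - f w.1| * `|g z.2| <= (M * `|z - w|) * N by exact: ler_pM.
have : `|f w.1| * `|g z.2 - g w.2| <= M * (N * `|z - w|) by exact: ler_pM.
by nra.
Qed.

(** Both bounds are proportional to [|c|], with one constant for all centers: bumps centered near
    the origin are then small enough for the multi-scale field to grow at most linearly. *)
Lemma plateau_bounds : exists M : R, 0 <= M /\
  (forall c z, `|plateau c z| <= M * `|c|) /\
  (forall c z w, `|plateau c z - plateau c w| <= M * `|c| * `|z - w|).
Proof.
have [M1 [M10 [b1 l1]]] := blip2 blip_cut blip_dlin.
have [M2 [M20 [b2 l2]]] := blip2 blip_lin blip_dcut.
have [M3 [M30 [b3 l3]]] := blip2 blip_dlin blip_cut.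
have [M4 [M40 [b4 l4]]] := blip2 blip_dcut blip_lin.
have comb (u v p q A B C : R) : `|u| <= C -> `|v| <= C -> `|p| <= A -> `|q| <= B ->
    `|u * p - v * q| <= (A + B) * C.
  move=> hu hv hp hq; apply: (le_trans (ler_normB _ _)); rewrite !normrM.
  have : `|u| * `|p| <= C * A by exact: ler_pM.
  have : `|v| * `|q| <= C * B by exact: ler_pM.
  by lra.
exists (M1 + M2 + M3 + M4); split; [lra|split] => [c z|c z w].
  have := lexx `|c|; rewrite {1}plane_norm_le /= => /andP[c1 c2].
  have := normr_ge0 c => c0.
  rewrite plane_norm_le /=; apply/andP; split.
    apply: (le_trans (comb _ _ _ _ _ _ _ c1 c2 (b1 z) (b2 z))).
    by rewrite ler_wpM2r//; lra.
  apply: (le_trans (comb _ _ _ _ _ _ _ c2 c1 (b3 z) (b4 z))).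
  by rewrite ler_wpM2r//; lra.
have := lexx `|c|; rewrite {1}plane_norm_le /= => /andP[c1 c2].
have c0 := mulr_ge0 (normr_ge0 c) (normr_ge0 (z - w)).
have alg (u v p q p' q' : R) : u * p - v * q - (u * p' - v * q') =
  u * (p - p') - v * (q - q') by ring.
rewrite plane_norm_le /= !alg; apply/andP; split.
  apply: (le_trans (comb _ _ _ _ _ _ _ c1 c2 (l1 z w) (l2 z w))).
  by have := mulr_ge0 M30 c0; have := mulr_ge0 M40 c0; nra.
apply: (le_trans (comb _ _ _ _ _ _ _ c2 c1 (l3 z w) (l4 z w))).
by have := mulr_ge0 M10 c0; have := mulr_ge0 M20 c0; nra.
Qed.

End cutoff.

(** With [K = C / (1 - s)] one has [K s + C = K], so the intervals of radius [K s^m] about [u m] are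
    nested; the supremum of their left ends lies in all of them. *)
Lemma geometric_limit (R : realType) (u : nat -> R) (C s : R) :
  0 < s -> s < 1 -> (forall m, `|u m.+1 - u m| <= C * s ^+ m) ->
  exists l, forall m, `|u m - l| <= C / (1 - s) * s ^+ m.
Proof.
move=> s0 s1 H; pose K := C / (1 - s).
have s1' : 0 < 1 - s by lra.
have KE : K * s + C = K by rewrite /K; field; lra.
have C0 : 0 <= C by have := le_trans (normr_ge0 _) (H 0%N); rewrite expr0 mulr1.
have K0 : 0 <= K by rewrite divr_ge0// ltW.
have sm m : 0 <= K * s ^+ m by rewrite mulr_ge0// exprn_ge0// ltW.
have CE m : C * s ^+ m = K * s ^+ m - K * s ^+ m.+1 by rewrite -{1}KE exprS; ring.
have up m k : u (m + k)%N + K * s ^+ (m + k) <= u m + K * s ^+ m.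
  elim: k => [|k IH]; first by rewrite addn0.
  apply: le_trans IH; rewrite addnS.
  by have := H (m + k)%N; rewrite CE ler_norml => /andP[? ?]; lra.
have dn m k : u m - K * s ^+ m <= u (m + k)%N - K * s ^+ (m + k).
  elim: k => [|k IH]; first by rewrite addn0.
  apply: (le_trans IH); rewrite addnS.
  by have := H (m + k)%N; rewrite CE ler_norml => /andP[? ?]; lra.
pose A := [set u m - K * s ^+ m | m in [set: nat]].
have ubA m : ubound A (u m + K * s ^+ m).
  move=> _ [k _ <-]; case/orP: (leq_total m k) => /subnKC <-.
    by have := up m (k - m)%N; have := sm (m + (k - m))%N; lra.
  by have := dn k (m - k)%N; have := sm (k + (m - k))%N; lra.
have hsA : has_sup A by split; [exists (u 0%N - K * s ^+ 0); exists 0%N|exists (u 0%N + K * s ^+ 0); exact: ubA].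
exists (sup A) => m; rewrite -/K ler_norml.
have h1 : sup A <= u m + K * s ^+ m by apply: ge_sup; [case: hsA|exact: ubA].
have h2 : u m - K * s ^+ m <= sup A by apply: ub_le_sup; [case: hsA|exists m].
by apply/andP; split; lra.
Qed.

Lemma plane_coord1 (R : realType) (x : R * R) : `|x.1| <= `|x|.
Proof. by have := lexx `|x|; rewrite {1}plane_norm_le => /andP[]. Qed.

Lemma plane_coord2 (R : realType) (x : R * R) : `|x.2| <= `|x|.
Proof. by have := lexx `|x|; rewrite {1}plane_norm_le => /andP[]. Qed.

(** The tool for passing to the limit in identities and bounds known up to [C s^m]; by contradiction
    it also provides a power below a given [e]. *)
Lemma le_geometric_eq0 (R : realType) (a C s : R) : 0 < s -> s < 1 ->
  (forall m, a <= C * s ^+ m) -> a <= 0.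
Proof.
move=> s0 s1 H.
have cv : (fun m => C * s ^+ m) @ \oo --> C * 0.
  by apply: cvgMr; apply: cvg_expr; rewrite ger0_norm// ltW.
rewrite -(mulr0 C); apply: (cvgr_to_ge cv); exact: nearW.
Qed.

(** * A bump carrying a rescaled copy of a field *)

Section block.
Variables (R : realType) (tau : R).
Hypotheses (tau0 : 0 < tau) (tau_half : tau < 1/2).
Implicit Types (c x y : R * R) (V : R * R -> R * R) (r s : R).

(** Positions and values of [V] are scaled by the same [s]: the copy keeps the Lipschitz constant of
    [V], and if [V] fixes [z], then the block fixes [c + s z] as long as that point lies on the
    plateau. *)
Definition block c r s V x : R * R :=
  plateau tau c (r^-1 *: (x - c)) + s *: V (s^-1 *: (x - c)).

Definition unit_supp V := forall z : R * R, 1 <= `|z| -> V z = 0.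

Lemma norm_scale_inv r x : 0 < r -> `|r^-1 *: x| = `|x| / r.
Proof. by move=> r0; rewrite prod_norm_scale normfV gtr0_norm// mulrC. Qed.

Lemma block_out c r s V x : 0 < r -> 0 < s -> s <= r / 2 -> unit_supp V ->
  r / 2 <= `|x - c| -> block c r s V x = 0.
Proof.
move=> r0 s0 sr V0 h; rewrite /block plateau_out ?V0 ?scaler0 ?addr0//.
  by rewrite norm_scale_inv// ler_pdivlMr// mul1r; lra.
by rewrite norm_scale_inv// ler_pdivlMr//; lra.
Qed.

Lemma block_in c r s V x : 0 < r -> `|x - c| <= tau * r ->
  block c r s V x = c + s *: V (s^-1 *: (x - c)).
Proof.
by move=> r0 h; rewrite /block plateau_in// norm_scale_inv// ler_pdivrMr.
Qed.

Lemma block_mid c r s V x : 0 < s -> unit_supp V -> s <= `|x - c| ->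
  block c r s V x = plateau tau c (r^-1 *: (x - c)).
Proof.
by move=> s0 V0 h; rewrite /block V0 ?scaler0 ?addr0// norm_scale_inv// ler_pdivlMr// mul1r.
Qed.

Lemma block_bound M N c r s V : 0 < s -> (forall c z, `|plateau tau c z| <= M * `|c|) ->
  (forall z, `|V z| <= N) -> forall x, `|block c r s V x| <= M * `|c| + s * N.
Proof.
move=> s0 hM hV x; apply: (le_trans (ler_normD _ _)); apply: lerD => //.
by rewrite prod_norm_scale gtr0_norm// ler_pM2l.
Qed.

Lemma block_lip M L c r s V : 0 < r -> 0 < s ->
  (forall c z w, `|plateau tau c z - plateau tau c w| <= M * `|c| * `|z - w|) ->
  (forall z w, `|V z - V w| <= L * `|z - w|) ->
  forall x y, `|block c r s V x - block c r s V y| <= (M * `|c| / r + L) * `|x - y|.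
Proof.
move=> r0 s0 hM hV x y; rewrite /block opprD addrACA.
apply: (le_trans (ler_normD _ _)); rewrite mulrDl; apply: lerD.
  apply: (le_trans (hM _ _ _)).
  by rewrite -scalerBr opprB addrA subrK norm_scale_inv// mulrA mulrAC.
rewrite -scalerBr prod_norm_scale gtr0_norm//.
apply: (@le_trans _ _ (s * (L * (`|x - y| / s)))); last first.
  by rewrite le_eqVlt; apply/orP; left; apply/eqP; field; lra.
rewrite ler_pM2l//; apply: (le_trans (hV _ _)).
by rewrite -scalerBr opprB addrA subrK norm_scale_inv.
Qed.

End block.

(** * The field made of four bumps that contain copies of itself *)

Section self_similar.
Variables (R : realType) (sigma : R).
Hypotheses (sigma4 : 1/4 <= sigma) (sigma_half : sigma < 1/2).
Implicit Types (x y : R * R) (V : R * R -> R * R).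

(** Halfway between [sigma] and [1/2]: this leaves a gap between the copy and the edge of its
    plateau, and a layer in which the plateau can decay. *)
Let tau := (sigma + 1/2) / 2.

Let sigma0 : 0 < sigma. Proof. by have := sigma4; lra. Qed.
Let tau0 : 0 < tau. Proof. by rewrite /tau; have := sigma4; lra. Qed.
Let tau_half : tau < 1/2. Proof. by rewrite /tau; have := sigma_half; lra. Qed.
Let sigma_tau : sigma < tau. Proof. by rewrite /tau; have := sigma_half; lra. Qed.

Definition sgh (b : bool) : R := if b then 1/2 else - (1/2).
Definition corner (d : bool * bool) : R * R := (sgh d.1, sgh d.2).

(** The self-reference is resolved as a fixed point: the field is the limit of the iterates of this
    operator from 0. *)
Definition refine V x : R * R := \sum_d block tau (corner d) 1 sigma V x.

Lemma norm_corner d : `|corner d| = 1/2.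
Proof.
rewrite prod_normE /= /sgh.
have h : `|- (1/2) : R| = 1/2 by rewrite normrN ger0_norm//; lra.
have h' : `|1/2 : R| = 1/2 by rewrite ger0_norm//; lra.
by case: d => -[] [] /=; rewrite ?h ?h' maxxx.
Qed.

Let sgh_sep (t : R) : exists b, forall b', b' != b -> 1/2 <= `|t - sgh b'|.
Proof.
have [h|h] := lerP 0 t; [exists true|exists false] => -[]// _; rewrite ler_normr /sgh; apply/orP.
  by left; lra.
by right; lra.
Qed.

(** Squares of half-width 1/2 about the four corners overlap only along their sides, so at every
    point at most one of the four blocks counts. *)
Lemma corner_sep x : exists d, forall d', d' != d -> 1/2 <= `|x - corner d'|.
Proof.
have [b1 h1] := sgh_sep x.1; have [b2 h2] := sgh_sep x.2.
exists (b1, b2) => -[d1 d2]; rewrite xpair_eqE negb_and plane_norm_ge /=.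
by case/orP => [/h1 ->//|/h2 ->]; rewrite orbT.
Qed.

Lemma corner_near x d : `|x - corner d| < 1/2 ->
  forall d', d' != d -> 1/2 <= `|x - corner d'|.
Proof.
move=> h; have [d0 h0] := corner_sep x.
have -> // : d = d0.
by apply/eqP; apply/negP => /negP /h0; rewrite leNgt h.
Qed.

Lemma refineE V x d : unit_supp V -> (forall d', d' != d -> 1/2 <= `|x - corner d'|) ->
  refine V x = block tau (corner d) 1 sigma V x.
Proof.
move=> V0 h; rewrite /refine (bigD1 d)//= big1 ?addr0// => d' /h hd.
by apply: block_out => //; have := sigma_half; lra.
Qed.

Lemma refine_supp V : unit_supp V -> unit_supp (refine V).
Proof.
move=> V0 x x1; rewrite /refine big1// => d _.
apply: block_out => //; first by have := sigma_half; lra.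
have := lerB_dist x (corner d); rewrite norm_corner; lra.
Qed.

Lemma refine_in V x d : unit_supp V -> `|x - corner d| <= tau ->
  refine V x = corner d + sigma *: V (sigma^-1 *: (x - corner d)).
Proof.
move=> V0 h; rewrite (refineE V0 (d := d)) ?block_in ?mulr1//.
by apply: corner_near; have := tau_half; lra.
Qed.

(** Only one block counts at [x], and its plateau term does not depend on the field, so just the
    copy scaled by [sigma] remains. *)
Lemma refine_contract V V' (e : R) : unit_supp V -> unit_supp V' ->
  (forall z, `|V z - V' z| <= e) ->
  forall x, `|refine V x - refine V' x| <= sigma * e.
Proof.
move=> V0 V0' h x; have [d hd] := corner_sep x.
rewrite !(refineE _ hd)// /block opprD addrACA subrr add0r -scalerBr.
by rewrite prod_norm_scale gtr0_norm ?sigma0// ler_pM2l ?sigma0.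
Qed.

(** Corners have norm 1/2 and [sigma < 1/2], so the new bound is at most [M/2 + N/2 <= N]. *)
Lemma refine_bound M N V : 0 <= M -> (forall c z, `|plateau tau c z| <= M * `|c|) ->
  M <= N -> unit_supp V ->
  (forall z, `|V z| <= N) -> forall x, `|refine V x| <= N.
Proof.
move=> M0 hM MN V0 hV x; have [d hd] := corner_sep x.
rewrite (refineE V0 hd); apply: (le_trans (block_bound _ _ _ hM hV _)) => //.
by rewrite norm_corner; have := sigma_half; have := sigma0; nra.
Qed.

(** The same [L] survives because the constants of plateau and copy never add up. Two points on one
    plateau see only the copy, whose constant is [L]. If one point lies within [sigma] of a corner
    and the other beyond [tau], they are [tau - sigma] apart and the sup bound [N] suffices. If no
    point is within [sigma] of a corner, only four plateaux of center norm 1/2 contribute, giving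
    [2 M]. *)
Lemma refine_lip M N L V : 0 <= M ->
  (forall c z, `|plateau tau c z| <= M * `|c|) ->
  (forall c z w, `|plateau tau c z - plateau tau c w| <= M * `|c| * `|z - w|) ->
  M <= N -> unit_supp V -> (forall z, `|V z| <= N) ->
  2 * M <= L -> 2 * N / (tau - sigma) <= L ->
  (forall z w, `|V z - V w| <= L * `|z - w|) ->
  forall x y, `|refine V x - refine V y| <= L * `|x - y|.
Proof.
move=> M0 hM hM' MN V0 hV ML; rewrite ler_pdivrMr; last by have := sigma_tau; lra.
move=> NL hL.
have bd := refine_bound M0 hM MN V0 hV.
have near_case d x y : `|x - corner d| < sigma ->
    `|refine V x - refine V y| <= L * `|x - y|.
  move=> hx; have [hy|hy] := lerP `|y - corner d| tau.
    rewrite !(refine_in (d := d))//; last by have := sigma_tau; lra.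
    rewrite opprD addrACA subrr add0r -scalerBr prod_norm_scale gtr0_norm ?sigma0//.
    apply: (@le_trans _ _ (sigma * (L * (`|x - y| / sigma)))); last first.
      by rewrite le_eqVlt; apply/orP; left; apply/eqP; field; have := sigma0; lra.
    rewrite ler_pM2l ?sigma0//; apply: (le_trans (hL _ _)).
    by rewrite -scalerBr opprB addrA subrK norm_scale_inv ?sigma0.
  have gap : tau - sigma <= `|x - y|.
    have := ler_distD x y (corner d); rewrite (distrC y x); lra.
  apply: (le_trans (ler_normB _ _)); have := bd x; have := bd y.
  have L0 : 0 <= L by lra.
  by nra.
move=> x y.
case: (pselect (exists d, `|x - corner d| < sigma)) => [[d]|hx]; first exact: near_case.
case: (pselect (exists d, `|y - corner d| < sigma)) => [[d hd]|hy].
  by rewrite distrC (distrC x); exact: near_case hd.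
have far z : ~ (exists d, `|z - corner d| < sigma) ->
    refine V z = \sum_d plateau tau (corner d) (z - corner d).
  move=> hz; apply: eq_bigr => d _; rewrite block_mid ?invr1 ?scale1r//.
  by rewrite leNgt; apply/negP => h; apply: hz; exists d.
rewrite !far// -sumrB.
apply: (le_trans (ler_norm_sum _ _ _)).
apply: (@le_trans _ _ (\sum_(d : bool * bool) M * (1/2) * `|x - y|)).
  apply: ler_sum => d _; apply: (le_trans (hM' _ _ _)).
  by rewrite norm_corner opprB addrA subrK.
rewrite sumr_const card_prod card_bool -mulr_natr.
have := normr_ge0 (x - y); nra.
Qed.

Definition refine_iter (m : nat) : R * R -> R * R := iter m refine (fun=> 0).

Lemma approx_supp m : unit_supp (refine_iter m).
Proof. by elim: m => // m; exact: refine_supp. Qed.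

Lemma approx_bound : exists N, forall m z, `|refine_iter m z| <= N.
Proof.
have [M [M0 [hM _]]] := plateau_bounds tau_half.
exists M; elim=> [|m IH] z; first by rewrite normr0.
by apply: (refine_bound M0 hM) => //; exact: approx_supp.
Qed.

Lemma approx_lip : exists L, forall m z w, `|refine_iter m z - refine_iter m w| <= L * `|z - w|.
Proof.
have [M [M0 [hM hM']]] := plateau_bounds tau_half.
have bd m z : `|refine_iter m z| <= M.
  elim: m z => [|m IH] z; first by rewrite normr0.
  by apply: (refine_bound M0 hM) => //; exact: approx_supp.
have st := sigma_tau.
have N0 : 0 <= 2 * M / (tau - sigma) by apply: divr_ge0; lra.
exists (2 * M + 2 * M / (tau - sigma)); elim=> [|m IH] z w.
  by rewrite subrr normr0; apply: mulr_ge0 => //; lra.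
by apply: (refine_lip M0 hM hM' (lexx M)) => //; [exact: approx_supp|lra|lra].
Qed.

Lemma approx_cauchy N m z : (forall m z, `|refine_iter m z| <= N) ->
  `|refine_iter m.+1 z - refine_iter m z| <= N * sigma ^+ m.
Proof.
move=> hN; elim: m z => [|m IH] z.
  by rewrite /= subr0 expr0 mulr1; exact: (hN 1%N).
rewrite exprS mulrCA.
exact: (@refine_contract (refine_iter m.+1) (refine_iter m) _ (@approx_supp _) (@approx_supp _) IH).
Qed.

(** The value at 0 and the functional equation yield the fixed points by induction on words; the
    rate of convergence lets the limit inherit weak divergence-freeness from the iterates. *)
Lemma self_similar_field : exists W : R * R -> R * R,
  [/\ unit_supp W,
      exists L, forall z w, `|W z - W w| <= L * `|z - w|,
      W 0 = 0,
      forall d z, `|z| <= 1 -> W (corner d + sigma *: z) = corner d + sigma *: W z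
    & exists C, forall m z, `|refine_iter m z - W z| <= C * sigma ^+ m].
Proof.
have [N hN] := approx_bound.
have s1 : sigma < 1 by have := sigma_half; lra.
have lims z : exists l : R * R, forall m, `|refine_iter m z - l| <= N / (1 - sigma) * sigma ^+ m.
  have hc m := approx_cauchy m z hN.
  have [l1 h1] := @geometric_limit R (fun m => (refine_iter m z).1) N sigma sigma0 s1
    (fun m => le_trans (plane_coord1 _) (hc m)).
  have [l2 h2] := @geometric_limit R (fun m => (refine_iter m z).2) N sigma sigma0 s1
    (fun m => le_trans (plane_coord2 _) (hc m)).
  by exists (l1, l2) => m; rewrite plane_norm_le; apply/andP; split; [exact: h1|exact: h2].
have {lims} [W] := choice lims; set K := N / (1 - sigma) => hW.
have eqlim (a b : R * R) C : (forall m, `|a - b| <= C * sigma ^+ m) -> a = b.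
  move=> h; apply/eqP; rewrite -subr_eq0 -normr_le0; apply: (le_geometric_eq0 sigma0 s1 h).
exists W; split.
- move=> z z1; apply: (@eqlim _ _ (K)) => m.
  by have := hW z m; rewrite (@approx_supp m z z1) sub0r normrN subr0.
- have [L hL] := approx_lip; exists L => z w.
  rewrite -subr_le0; apply: (@le_geometric_eq0 _ _ (2 * (K)) sigma sigma0 s1) => m.
  have := hW z m; have := hW w m; have := hL m z w.
  have := ler_normD (W z - refine_iter m z) (refine_iter m z - refine_iter m w + (refine_iter m w - W w)).
  have := ler_normD (refine_iter m z - refine_iter m w) (refine_iter m w - W w).
  rewrite !addrA !subrK (distrC (W z) (refine_iter m z)) -(mulrA 2 K) => h1 h2 h3 h4 h5; lra.
- apply: (@eqlim _ _ (K)) => -[|m].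
    by have := hW 0 0%N; rewrite /= sub0r normrN subr0.
  (* The origin is at distance exactly 1/2 from every corner, where each block vanishes. *)
  have := hW 0 m.+1; suff -> : refine_iter m.+1 0 = 0 by rewrite sub0r normrN subr0.
  rewrite /= /refine big1// => d _; apply: block_out => //.
  - by have := sigma_half; lra.
  - exact: approx_supp.
  - by rewrite sub0r normrN norm_corner.
- move=> d z z1; apply: (@eqlim _ _ (2 * (K))) => m.
  have := hW (corner d + sigma *: z) m.+1; have := hW z m.
  have -> : refine_iter m.+1 (corner d + sigma *: z) = corner d + sigma *: refine_iter m z.
    rewrite /= (refine_in (d := d)); last 2 first.
    - exact: approx_supp.
    - rewrite addrAC subrr add0r prod_norm_scale gtr0_norm ?sigma0//.
      by have := sigma_tau; have := sigma0; have := normr_ge0 z; nra.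
    by rewrite addrAC subrr add0r scalerA mulVf ?scale1r//; have := sigma0; lra.
  move=> h1 h2.
  have e : W (corner d + sigma *: z) - (corner d + sigma *: W z) =
    (W (corner d + sigma *: z) - (corner d + sigma *: refine_iter m z)) + sigma *: (refine_iter m z - W z).
    by rewrite scalerBr !opprD !addrA subrK.
  rewrite e; apply: (le_trans (ler_normD _ _)).
  rewrite prod_norm_scale gtr0_norm ?sigma0// (distrC (W _)).
  have K0 : 0 <= K * sigma ^+ m by apply: le_trans h1.
  move: h2; rewrite exprS => h2.
  by have := normr_ge0 (refine_iter m z - W z); have := sigma0; nra.
- by exists (K) => m z; exact: hW.
Qed.

End self_similar.

(** * Measurability and integrability on the plane *)

Section plane_measure.
Variable R : realType.
Implicit Types (x y : R * R) (f g : R * R -> R).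

(** Measurability here refers to the product sigma-algebra, so an open set is written as a countable
    union of squares with rational centers and radii [1/(n+1)]. *)
Lemma plane_open_measurable (A : set (R * R)) : open A -> measurable A.
Proof.
move=> oA.
pose B (q : rat * rat * nat) : set (R * R) :=
  ball (ratr q.1.1 : R) q.2.+1%:R^-1 `*` ball (ratr q.1.2 : R) q.2.+1%:R^-1.
have -> : A = \bigcup_q (if pselect (B q `<=` A) then B q else set0).
  apply/seteqP; split => [x Ax|x [q _]]; last by case: pselect => // qA; exact: qA.
  have /nbhs_ballP[e /= e0 eA] : nbhs x A by exact: open_nbhs_nbhs.
  have [n hn] : exists n : nat, n.+1%:R^-1 < e / 2.
    exists (Num.truncn (e / 2)^-1); rewrite invf_plt ?posrE//; last by rewrite divr_gt0.
    exact: truncnS_gt.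
  set d := n.+1%:R^-1 in hn.
  have d0 : 0 < d by rewrite invr_gt0.
  have ex (t : R) : exists q : rat, t - d < ratr q < t + d.
    have [|q] := @rat_in_itvoo R (t - d) (t + d); first lra.
    by rewrite in_itv; exists q.
  have [p /andP[p1 p2]] := ex x.1; have [q /andP[q1 q2]] := ex x.2.
  exists (p, q, n) => //; case: pselect => [?|]; last first.
    move=> h; exfalso; apply: h => y [/= y1 y2]; apply: eA; split => /=.
      move: y1; rewrite /ball /= -/d !ltr_distl => /andP[? ?]; lra.
    move: y2; rewrite /ball /= -/d !ltr_distl => /andP[? ?]; lra.
  by split; rewrite /ball /= -/d ltr_distl; lra.
apply: countable_bigcupT_measurable => [|q]; first exact: countableP.
case: pselect => ?; last exact: measurable0.
by apply: measurableX; apply: measurable_realfun.open_measurable; exact: ball_open.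
Qed.

Lemma plane_continuous_measurable f : continuous f -> measurable_fun setT f.
Proof.
move=> /continuousP cf; apply: (measurability _ (measurable_realfun.RGenOpens.measurableE R)).
move=> _ [_ [a [b ->] <-]]; rewrite setTI; apply: plane_open_measurable.
exact/cf/interval_open.
Qed.

Let box (K : R) : set (R * R) := `[- K, K] `*` `[- K, K].

Lemma continuous_plane_bounded f (K : R) : continuous f ->
  exists M, forall x, `|x| <= K -> `|f x| <= M.
Proof.
move=> cf.
have cb : compact (box K) by apply: compact_setX; exact: segment_compact.
have /compact_bounded[M [_ hM]] : compact (f @` box K).
  by apply: continuous_compact => //; exact: continuous_subspaceT.
exists (M + 1) => x; rewrite plane_norm_le => /andP[]; rewrite (ler_norml x.1) (ler_norml x.2) => x1 x2.
have M1 : M < M + 1 by rewrite ltrDl.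
have := hM _ M1; rewrite /globally /= => h; apply: h.
by exists x => //; split; rewrite /= in_itv.
Qed.

Lemma plane_integrable f (M : R) : continuous f -> (forall x, M < `|x| -> f x = 0) ->
  (@leb2 R).-integrable setT (EFin \o f).
Proof.
move=> cf f0; pose K := `|M| + 1.
have MK : M < K by rewrite /K; have := ler_norm M; lra.
have K0 : 0 < K by rewrite /K; have := normr_ge0 M; lra.
have mB : measurable (box K) by apply: measurableX; exact: measurable_itv.
have -> : EFin \o f = (EFin \o f) \_ (box K).
  apply/funext => x; rewrite patchE; case: ifPn => //= /negP hx.
  rewrite f0//; apply: (lt_le_trans MK); rewrite leNgt; apply/negP => h; apply: hx.
  move: h; rewrite inE plane_norm_lt !ltr_norml => /andP[/andP[? ?] /andP[? ?]].
  by split; rewrite /= in_itv /=; apply/andP; split; exact: ltW.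
have [C hC] := continuous_plane_bounded K cf.
apply/integrable_restrict => //; rewrite setTI.
apply: measurable_bounded_integrable => //.
- have mI : measurable (`[- K, K]%classic : set R) by exact: measurable_itv.
  have e := product_measure1E (@lebesgue_measure R) (@lebesgue_measure R) mI mI.
  have l : (@lebesgue_measure R (`[(- K)%R, K]%classic : set R) < +oo)%E.
    by rewrite lebesgue_measure_itv/=; case: ifP => _; rewrite -?EFinD ltry.
  by rewrite [ltLHS]e lte_mul_pinfty// ge0_fin_numE.
- by apply: measurable_funTS; exact: plane_continuous_measurable.
- exists C; split; first exact: num_real.
  move=> D CD x [/= x1 x2]; apply: le_trans (ltW CD); apply: hC.
  by move: x1 x2; rewrite plane_norm_le !ler_norml !in_itv /= => -> ->.
Qed.

End plane_measure.

(** * Test functions and directional derivatives *)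

Section test_functions.
Variables (R : realType) (V : normedModType R).
Implicit Types (f g : V -> R) (v x : V).

Lemma test_fun_continuous f : test_fun f -> continuous f.
Proof. by case=> /(_ 0%N). Qed.

Lemma test_fun_derivable f v x : test_fun f -> derivable f x v.
Proof. by case=> /(_ 1%N)[_ /(_ v)[]]. Qed.

Lemma test_fun_continuous_derive f v : test_fun f -> continuous ('D_v f).
Proof. by case=> /(_ 1%N)[_ /(_ v)[]]. Qed.

Lemma derive_supp f v (M : R) : (forall x, M < `|x| -> f x = 0) ->
  forall x, M < `|x| -> 'D_v f x = 0.
Proof.
move=> f0 x Mx; rewrite (@near_eq_derive _ _ _ f (cst 0)); first by rewrite derive_cst.
have : \forall y \near x, M < `|y|.
  exact: (@cvgr_gt R V (nbhs x) _ (fun y => `|y|) `|x| (@norm_continuous _ V x) M Mx).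
by apply: filterS => y; exact: f0.
Qed.

Lemma is_derive_line f v x (t : R) : derivable f (t *: v + x) v ->
  is_derive t 1 (fun s : R => f (s *: v + x)) ('D_v f (t *: v + x)).
Proof.
have e : (fun h : R => h^-1 *: (f ((h *: (1 : R) + t) *: v + x) - f (t *: v + x))) =
  (fun h : R => h^-1 *: (f (h *: v + (t *: v + x)) - f (t *: v + x))).
  by apply/funext => h; have -> : h *: (1 : R) = h by [exact: mulr1]; rewrite scalerDl addrA.
by move=> df; split; rewrite /derivable /derive /= e.
Qed.

(** The parameters come in any order, possibly equal, because coordinate increments have no fixed
    sign where this is applied. *)
Lemma mvt_line f v x (a b : R) : (forall x, derivable f x v) ->
  exists2 t, Num.min a b <= t <= Num.max a b &
    f (b *: v + x) - f (a *: v + x) = (b - a) * 'D_v f (t *: v + x).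
Proof.
move=> df.
have main (c d : R) : c < d -> exists2 t, c <= t <= d &
    f (d *: v + x) - f (c *: v + x) = (d - c) * 'D_v f (t *: v + x).
  move=> cd.
  have dl t := is_derive_line (df (t *: v + x)).
  have cf : {within `[c, d], continuous (fun s : R => f (s *: v + x))}.
    by apply: derivable_within_continuous => z _; have := dl z => -[].
  have [t] := @MVT R (fun s : R => f (s *: v + x)) (fun t => 'D_v f (t *: v + x)) _ _ cd (fun z _ => dl z) cf.
  by rewrite in_itv /= => /andP[/ltW ? /ltW ?] ->; exists t; [apply/andP|rewrite mulrC].
case: (ltgtP a b) => [/main//|/main[t ht e]|->].
  by exists t => //; rewrite -opprB e -mulNr opprB.
by exists b; rewrite ?lexx// !subrr mul0r.
Qed.

End test_functions.

(** * Continuity of combinations, and the fundamental theorem of calculus *)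

Section continuity.
Variables (R : realType) (T : topologicalType).
Implicit Types f g : T -> R.

Lemma continuous_add f g : continuous f -> continuous g -> continuous (fun x => f x + g x).
Proof. by move=> cf cg x; apply: cvgD; [exact: cf|exact: cg]. Qed.

Lemma continuous_sub f g : continuous f -> continuous g -> continuous (fun x => f x - g x).
Proof. by move=> cf cg x; apply: cvgB; [exact: cf|exact: cg]. Qed.

Lemma continuous_mul f g : continuous f -> continuous g -> continuous (fun x => f x * g x).
Proof. by move=> cf cg x; apply: cvgM; [exact: cf|exact: cg]. Qed.

Lemma continuous_after (U W : topologicalType) (f : T -> U) (g : U -> W) :
  continuous f -> continuous g -> continuous (fun x => g (f x)).
Proof. by move=> cf cg x; apply: continuous_comp; [exact: cf|exact: cg]. Qed.

End continuity.

Lemma continuous_fst (T U : topologicalType) : continuous (@fst T U).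
Proof. by move=> x; exact: cvg_fst. Qed.

Lemma continuous_snd (T U : topologicalType) : continuous (@snd T U).
Proof. by move=> x; exact: cvg_snd. Qed.

Lemma continuous_pair (T U W : topologicalType) (f : T -> U) (g : T -> W) :
  continuous f -> continuous g -> continuous (fun x => (f x, g x)).
Proof. by move=> cf cg x; apply: cvg_pair; [exact: cf|exact: cg]. Qed.

Lemma is_derive_continuous (R : realType) (F dF : R -> R) :
  (forall x : R, is_derive x 1 F (dF x)) -> continuous F.
Proof.
move=> h x; apply: differentiable_continuous; apply/derivable1_diffP.
by have := h x => -[].
Qed.

Lemma integral_is_derive (R : realType) (F dF : R -> R) (a b : R) : a < b ->
  (forall x : R, is_derive x 1 F (dF x)) -> continuous dF ->
  (\int[lebesgue_measure]_(x in `[a, b]) (dF x)%:E = (F b - F a)%:E)%E.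
Proof.
move=> ab hF cdF; have cF := is_derive_continuous hF.
rewrite (@continuous_FTC2 _ _ F)//.
- exact: continuous_subspaceT.
- split => [x _||]; first by have := hF x => -[].
    by apply: cvg_at_right_filter; exact: cF.
  by apply: cvg_at_left_filter; exact: cF.
- by move=> x _; rewrite derive1E; have := hF x => -[].
Qed.

Lemma integral_is_derive_supp (R : realType) (F dF : R -> R) (K : R) : 0 < K ->
  (forall x : R, is_derive x 1 F (dF x)) -> continuous dF ->
  (forall x : R, K <= `|x| -> F x = 0) -> (forall x : R, K <= `|x| -> dF x = 0) ->
  (\int[lebesgue_measure]_x (dF x)%:E = 0)%E.
Proof.
move=> K0 hF cdF F0 dF0.
have -> : (fun x => (dF x)%:E) = (fun x => (dF x)%:E) \_ `[- K, K].
  apply/funext => x; rewrite patchE; case: ifPn => // /negP hx.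
  rewrite dF0// leNgt; apply/negP => /ltW h; apply: hx.
  by rewrite inE /= in_itv /= -ler_norml.
rewrite -integral_mkcond integral_is_derive//; last by lra.
by rewrite !F0 ?subrr// ?normrN ger0_norm// ltW.
Qed.

(** * Weak divergence-freeness of a steady field *)

Section solenoidal.
Variable R : realType.
Implicit Types (V W : R * R -> R * R) (psi : R * R -> R).

Definition flux V psi (x : R * R) : R :=
  (V x).1 * 'D_((1 : R), (0 : R)) psi x + (V x).2 * 'D_((0 : R), (1 : R)) psi x.

Definition solenoidal V := continuous V /\ forall psi, test_fun psi ->
  (\int[@leb2 R]_x (flux V psi x)%:E = 0)%E.

Lemma continuous_flux V psi : continuous V -> test_fun psi -> continuous (flux V psi).
Proof.
move=> cV tp; apply: continuous_add; apply: continuous_mul;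
  do ?exact: test_fun_continuous_derive; apply: (continuous_after cV).
  exact: continuous_fst.
exact: continuous_snd.
Qed.

Lemma flux_supp psi : test_fun psi -> exists M, forall V x, M < `|x| -> flux V psi x = 0.
Proof.
case=> _ [M hM]; exists M => V x Mx; rewrite /flux.
by rewrite !(derive_supp _ hM)// !mulr0 addr0.
Qed.

Lemma integrable_flux V psi : continuous V -> test_fun psi ->
  (@leb2 R).-integrable setT (EFin \o flux V psi).
Proof.
move=> cV tp; have [M hM] := flux_supp tp.
by apply: (@plane_integrable _ _ M); [exact: continuous_flux|exact: hM].
Qed.

Lemma solenoidal_add V W : solenoidal V -> solenoidal W -> solenoidal (fun x => V x + W x).
Proof.
move=> [cV hV] [cW hW]; split; first by move=> x; apply: cvgD; [exact: cV|exact: cW].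
move=> psi tp.
have -> : (fun x => (flux (fun x => V x + W x) psi x)%:E) =
    ((EFin \o flux V psi) \+ (EFin \o flux W psi))%E.
  by apply/funext => x; rewrite /= -EFinD; congr EFin; rewrite /flux /=; ring.
rewrite integralD_EFin//; [|exact: integrable_flux..].
by rewrite hV// hW// adde0.
Qed.

(** The flux integral of [V] equals that of [V - W], which is at most [e] times the integral of the
    absolute partial derivatives of [psi], a finite quantity independent of [W]. *)
Lemma solenoidal_uniform V : continuous V ->
  (forall e : R, 0 < e -> exists W, solenoidal W /\ forall x, `|W x - V x| <= e) ->
  solenoidal V.
Proof.
move=> cV H; split=> // psi tp.
have iV := integrable_flux cV tp.
pose N (x : R * R) : R := `|'D_((1 : R), (0 : R)) psi x| + `|'D_((0 : R), (1 : R)) psi x|.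
have cN : continuous N.
  by apply: continuous_add; apply: (continuous_after (test_fun_continuous_derive tp));
     exact: norm_continuous.
have iN : (@leb2 R).-integrable setT (EFin \o N).
  have [M hM] := tp.2; apply: (@plane_integrable _ _ M) => // x Mx.
  by rewrite /N !(derive_supp _ hM)// normr0 addr0.
have fN := integrable_fin_num measurableT iN.
have fV := integrable_fin_num measurableT iV.
set I := (X in X = _); rewrite -/I in fV.
set J := (X in X \is a fin_num) in fN.
suff : forall e : R, 0 < e -> (`|I| <= e%:E * J)%E.
  rewrite -(fineK fV) -(fineK fN) => h.
  have h' e : 0 < e -> `|fine I| <= e * fine J.
    by move=> /h; rewrite -EFinM lee_fin.
  congr EFin; apply/eqP; rewrite -normr_le0 leNgt; apply/negP => I0.
  have := h' (`|fine I| / (2 * (`|fine J| + 1))).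
  have J0 := normr_ge0 (fine J); have Jle := ler_norm (fine J).
  rewrite divr_gt0//.
  move=> /(_ isT); rewrite mulrAC ler_pdivlMr; last by lra.
  by nra.
move=> e e0; have [W [[cW hW] We]] := H e e0.
have iW := integrable_flux cW tp.
have -> : I = (\int[@leb2 R]_x ((flux V psi x)%:E - (flux W psi x)%:E))%E.
  by rewrite integralB_EFin// hW// sube0.
apply: (le_trans (le_abse_integral _ _ _)) => //.
  by apply: emeasurable_funB; [case/integrableP: iV|case/integrableP: iW].
rewrite /J -integralZl//.
apply: ge0_le_integral => //.
- apply/measurable_EFinP; apply: plane_continuous_measurable.
  apply: (@continuous_after _ _ _ (fun x => flux V psi x - flux W psi x) (fun t : R => `|t|)).
    by apply: continuous_sub; exact: continuous_flux.
  exact: norm_continuous.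
- by apply: measurable_funeM; case/integrableP: iN.
move=> x _; rewrite lee_fin.
have := We x; rewrite distrC plane_norm_le => /andP[/= l1 l2].
have -> : flux V psi x - flux W psi x =
   ((V x).1 - (W x).1) * 'D_((1 : R), (0 : R)) psi x +
   ((V x).2 - (W x).2) * 'D_((0 : R), (1 : R)) psi x by rewrite /flux; ring.
apply: (le_trans (ler_normD _ _)); rewrite !normrM mulrDr.
by apply: lerD; apply: ler_wpM2r.
Qed.

(* The flux of the field with stream function f(x1) g(x2) against grad psi is
   d1(g'(x2) f(x1) psi) - d2(f'(x1) g(x2) psi), so only first derivatives of psi occur. *)
Lemma solenoidal_stream (f df g dg : R -> R) (K : R) : 0 < K ->
  (forall s : R, is_derive s 1 f (df s)) -> (forall s : R, is_derive s 1 g (dg s)) ->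
  continuous df -> continuous dg ->
  (forall s : R, K <= `|s| -> f s = 0) -> (forall s : R, K <= `|s| -> df s = 0) ->
  (forall s : R, K <= `|s| -> g s = 0) -> (forall s : R, K <= `|s| -> dg s = 0) ->
  solenoidal (fun x => (f x.1 * dg x.2, - (df x.1 * g x.2))).
Proof.
move=> K0 hf hg cdf cdg f0 df0 g0 dg0.
have cf := is_derive_continuous hf; have cg := is_derive_continuous hg.
have c1 (h : R -> R) : continuous h -> continuous (fun x : R * R => h x.1).
  by move=> ch; apply: (continuous_after (@continuous_fst _ _) ch).
have c2 (h : R -> R) : continuous h -> continuous (fun x : R * R => h x.2).
  by move=> ch; apply: (continuous_after (@continuous_snd _ _) ch).
split.
  apply: continuous_pair; first by apply: continuous_mul; [exact: c1|exact: c2].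
  by move=> x; apply: cvgN; apply: (continuous_mul (c1 _ cdf) (c2 _ cg)).
move=> psi tp; have cp := test_fun_continuous tp.
set d1 := 'D_((1 : R), (0 : R)) psi; set d2 := 'D_((0 : R), (1 : R)) psi.
have cd1 : continuous d1 by exact: test_fun_continuous_derive.
have cd2 : continuous d2 by exact: test_fun_continuous_derive.
pose A (x : R * R) : R := dg x.2 * (df x.1 * psi x + f x.1 * d1 x).
pose B (x : R * R) : R := df x.1 * (dg x.2 * psi x + g x.2 * d2 x).
have cA : continuous A.
  by apply: continuous_mul (c2 _ cdg) _; apply: continuous_add; apply: continuous_mul => //; exact: c1.
have cB : continuous B.
  by apply: continuous_mul (c1 _ cdf) _; apply: continuous_add; apply: continuous_mul => //; exact: c2.
have A0 x : K < `|x| -> A x = 0.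
  move=> /ltW; rewrite plane_norm_ge => /orP[h|h]; first by rewrite /A f0// df0// !mul0r addr0 mulr0.
  by rewrite /A dg0// mul0r.
have B0 x : K < `|x| -> B x = 0.
  move=> /ltW; rewrite plane_norm_ge => /orP[h|h]; first by rewrite /B df0// mul0r.
  by rewrite /B g0// dg0// !mul0r addr0 mulr0.
have iA := plane_integrable cA A0; have iB := plane_integrable cB B0.
have line1 (s y : R) : is_derive s 1 (fun t => psi (t, y)) (d1 (s, y)).
  have := @is_derive_line R _ psi (1, 0) (0, y) s (@test_fun_derivable R _ psi _ _ tp).
  have e (t : R) : t *: ((1 : R), (0 : R)) + (0, y) = (t, y).
    by apply: plane_eq; rewrite /= /GRing.scale /= ?mulr1 ?mulr0 ?addr0 ?add0r.
  by rewrite e; congr is_derive; apply/funext => t; rewrite e.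
have line2 (s y : R) : is_derive s 1 (fun t => psi (y, t)) (d2 (y, s)).
  have := @is_derive_line R _ psi (0, 1) (y, 0) s (@test_fun_derivable R _ psi _ _ tp).
  have e (t : R) : t *: ((0 : R), (1 : R)) + (y, 0) = (y, t).
    by apply: plane_eq; rewrite /= /GRing.scale /= ?mulr1 ?mulr0 ?addr0 ?add0r.
  by rewrite e; congr is_derive; apply/funext => t; rewrite e.
have sec1 (y : R) : continuous (fun s : R => (s, y)).
  by apply: continuous_pair => [s|s]; [exact: cvg_id|exact: cvg_cst].
have sec2 (y : R) : continuous (fun s : R => (y, s)).
  by apply: continuous_pair => [s|s]; [exact: cvg_cst|exact: cvg_id].
have IA : (\int[@leb2 R]_x (A x)%:E = 0)%E.
  have := @integral21_prod_meas1 _ _ _ _ R (@lebesgue_measure R) (@lebesgue_measure R) _ iA.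
  move=> <-; apply: integral0_eq => y _; rewrite /fubini_G.
  apply: (@integral_is_derive_supp R (fun s => dg y * (f s * psi (s, y))) (fun s => A (s, y)) K) => //.
  - move=> s; have := is_derive_mul (is_derive_cst (dg y) s 1) (is_derive_mul (hf s) (line1 s y)).
    by congr is_derive; rewrite /A /= mul0r add0r.
  - exact: (continuous_after (sec1 y) cA).
  - by move=> s h; rewrite f0// mul0r mulr0.
  - by move=> s h; rewrite /A /= f0// df0// !mul0r addr0 mulr0.
have IB : (\int[@leb2 R]_x (B x)%:E = 0)%E.
  have := @integral12_prod_meas1 _ _ _ _ R (@lebesgue_measure R) (@lebesgue_measure R) _ iB.
  move=> <-; apply: integral0_eq => y _; rewrite /fubini_F.
  apply: (@integral_is_derive_supp R (fun s => df y * (g s * psi (y, s))) (fun s => B (y, s)) K) => //.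
  - move=> s; have := is_derive_mul (is_derive_cst (df y) s 1) (is_derive_mul (hg s) (line2 s y)).
    by congr is_derive; rewrite /B /= mul0r add0r.
  - exact: (continuous_after (sec2 y) cB).
  - by move=> s h; rewrite g0// mul0r mulr0.
  - by move=> s h; rewrite /B /= g0// dg0// !mul0r addr0 mulr0.
have -> : (fun x => (flux (fun x => (f x.1 * dg x.2, - (df x.1 * g x.2))) psi x)%:E) =
   (fun x => (A x)%:E - (B x)%:E)%E.
  apply/funext => x; rewrite -EFinB; congr EFin.
  have alg (a b c d p q r : R) : a * b * p + - (c * d) * q = b * (c * r + a * p) - c * (b * r + d * q) by ring.
  exact: alg.
by rewrite integralB_EFin// IA IB sube0.
Qed.

End solenoidal.

(** * Divergence-freeness of all rescaled and translated copies *)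

Section scaled_solenoidal.
Variable R : realType.
Implicit Types (V W : R * R -> R * R) (a r : R) (c : R * R).

(** Invariance under scaling and translation is built in: the copies inside blocks and the velocity
    at each time are then instances, and no change of variables in a plane integral is required. *)
Definition ssol V := forall a c r, 0 < r ->
  solenoidal (fun x => a *: V (r^-1 *: (x - c))).

Lemma ssol_add V W : ssol V -> ssol W -> ssol (fun x => V x + W x).
Proof.
move=> hV hW a c r r0; have := solenoidal_add (hV a c r r0) (hW a c r r0).
by congr solenoidal; apply/funext => x; rewrite [RHS]scalerDr.
Qed.

Lemma ssol_scale V a c r : 0 < r -> ssol V -> ssol (fun x => a *: V (r^-1 *: (x - c))).
Proof.
move=> r0 hV a' c' r' r'0; have := hV (a' * a) (c' + r' *: c) (r' * r) (mulr_gt0 r'0 r0).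
congr solenoidal; apply/funext => x; rewrite scalerA; congr (_ *: V _).
rewrite invfM mulrC -scalerA; congr (_ *: _).
by rewrite opprD addrA scalerBr scalerA mulVf ?scale1r// gt_eqF.
Qed.

Lemma ssol_continuous V : ssol V -> continuous V.
Proof.
move=> /(_ 1 0 1 ltr01)[+ _]; rewrite [X in continuous X -> _](_ : _ = V)//.
by apply/funext => x; rewrite scale1r subr0 invr1 scale1r.
Qed.

Lemma ssol_uniform V : continuous V ->
  (forall e : R, 0 < e -> exists W, ssol W /\ forall x, `|W x - V x| <= e) -> ssol V.
Proof.
move=> cV H a c r r0; apply: solenoidal_uniform.
  have cs : continuous (fun x : R * R => r^-1 *: (x - c)).
    by move=> x; apply: cvgZr; apply: cvgB; [exact: cvg_id|exact: cvg_cst].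
  by move=> x; apply: cvgZr; apply: (continuous_after cs cV).
move=> e e0; have a1 : 0 < `|a| + 1 by have := normr_ge0 a; lra.
have [W [sW We]] := H (e / (`|a| + 1)) (divr_gt0 e0 a1).
exists (fun x => a *: W (r^-1 *: (x - c))); split; first exact: sW.
move=> x; rewrite -scalerBr prod_norm_scale.
have := We (r^-1 *: (x - c)); rewrite ler_pdivlMr//.
by have := normr_ge0 (W (r^-1 *: (x - c)) - V (r^-1 *: (x - c))); have := normr_ge0 a; nra.
Qed.

(** Rescaling the field amounts to rescaling the two one-variable profiles; the factor [a * r] on
    the first one compensates the [1/r] from the chain rule. *)
Lemma ssol_stream (f df g dg : R -> R) (K : R) : 0 < K ->
  (forall s : R, is_derive s 1 f (df s)) -> (forall s : R, is_derive s 1 g (dg s)) ->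
  continuous df -> continuous dg ->
  (forall s : R, K <= `|s| -> f s = 0) -> (forall s : R, K <= `|s| -> df s = 0) ->
  (forall s : R, K <= `|s| -> g s = 0) -> (forall s : R, K <= `|s| -> dg s = 0) ->
  ssol (fun x => (f x.1 * dg x.2, - (df x.1 * g x.2))).
Proof.
move=> K0 hf hg cdf cdg f0 df0 g0 dg0 a c r r0.
have rn : r != 0 by rewrite gt_eqF.
(* The rescaled profiles are centered at [c.1] and [c.2]; one radius about 0 serves for both. *)
pose K' := r * K + `|c.1| + `|c.2|.
have n1 := normr_ge0 c.1; have n2 := normr_ge0 c.2.
have rK := mulr_gt0 r0 K0.
have K'0 : 0 < K' by rewrite /K'; lra.
pose z (b s : R) : R := r^-1 * (s - b).
have far b s : `|b| <= `|c.1| + `|c.2| -> K' <= `|s| -> K <= `|z b s|.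
  move=> hb hs; rewrite /z normrM normfV (gtr0_norm r0) ler_pdivlMl//.
  by have := lerB_dist s b; move: hs; rewrite /K'; lra.
have dz (b s : R) : is_derive s 1 (z b) r^-1.
  apply: (@is_derive_quadratic _ _ _ _ 0) => h.
  by rewrite mul0r normr_le0 /z; apply/eqP; ring.
have cz (b : R) : continuous (z b) by apply: is_derive_continuous; exact: dz.
have scl (F dF : R -> R) (b k : R) : (forall s : R, is_derive s 1 F (dF s)) ->
    forall s : R, is_derive s 1 (fun s => k * F (z b s)) (k * (dF (z b s) * r^-1)).
  move=> hF s; have := is_derive_mul (is_derive_cst k s 1)
    (@is_derive1_comp R F (z b) s _ _ (hF (z b s)) (dz b s)).
  by congr is_derive; rewrite /= mul0r add0r.
have clip (F : R -> R) (b k : R) : continuous F -> continuous (fun s => k * (F (z b s) * r^-1)).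
  move=> cF; apply: continuous_mul; first by move=> ?; exact: cvg_cst.
  apply: continuous_mul; last by move=> ?; exact: cvg_cst.
  exact: (continuous_after (cz b) cF).
have b1 : `|c.1| <= `|c.1| + `|c.2| by lra.
have b2 : `|c.2| <= `|c.1| + `|c.2| by lra.
have := solenoidal_stream K'0 (scl f df c.1 (a * r) hf) (scl g dg c.2 1 hg)
  (clip _ _ _ cdf) (clip _ _ _ cdg).
have -> : (fun x : R * R => (a * r * f (z c.1 x.1) * (1 * (dg (z c.2 x.2) * r^-1)),
    - (a * r * (df (z c.1 x.1) * r^-1) * (1 * g (z c.2 x.2))))) =
  (fun x => a *: ((fun x : R * R => (f x.1 * dg x.2, - (df x.1 * g x.2))) (r^-1 *: (x - c)))).
  apply/funext => x; apply: plane_eq; rewrite /= /GRing.scale /= -/(z c.1 x.1) -/(z c.2 x.2).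
    by field.
  by field.
by apply=> s hs; rewrite ?f0 ?df0 ?g0 ?dg0 ?mul0r ?mulr0//; apply: far.
Qed.

Lemma ssol_plateau (tau : R) c : 0 < tau -> tau < 1/2 -> ssol (plateau tau c).
Proof.
move=> t0 t1; have h0 : (0 : R) < 1/2 by lra.
have blipc (f : R -> R) : blip f -> continuous f.
  by case=> M [_]; exact: continuous_lipschitz.
have d1 := @is_derive_cut R tau; have d2 := @is_derive_lin R tau.
have cd1 := blipc _ (blip_dcut tau); have cd2 := blipc _ (blip_dlin t1).
have o1 := @cut_out R tau t1; have o2 := @dcut_out R tau t1.
have o3 := @lin_out R tau t1; have o4 := @dlin_out R tau t1.
have s1 := ssol_stream h0 d1 d2 cd1 cd2 o1 o2 o3 o4.
have s2 := ssol_stream h0 d2 d1 cd2 cd1 o3 o4 o1 o2.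
have := ssol_add (ssol_scale c.1 0 ltr01 s1) (ssol_scale (- c.2) 0 ltr01 s2).
congr ssol; apply/funext => x; apply: plane_eq;
by rewrite /= /GRing.scale /= invr1 !subr0 !mul1r /=; ring.
Qed.

Lemma ssol_block (tau : R) c r s V : 0 < tau -> tau < 1/2 -> 0 < r -> 0 < s ->
  ssol V -> ssol (block tau c r s V).
Proof.
move=> t0 t1 r0 s0 sV.
have := ssol_add (ssol_scale 1 c r0 (ssol_plateau c t0 t1)) (ssol_scale s c s0 sV).
by congr ssol; apply/funext => x; rewrite scale1r.
Qed.

Lemma ssol0 : ssol (fun=> 0).
Proof.
move=> a c r r0; split; first by move=> x; rewrite /= scaler0; exact: cvg_cst.
move=> psi tp; apply: integral0_eq => x _.
by rewrite /flux scaler0 /= !mul0r addr0.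
Qed.

Lemma ssol_sum (I : Type) (s : seq I) (F : I -> R * R -> R * R) :
  (forall i, ssol (F i)) -> ssol (fun x => \sum_(i <- s) F i x).
Proof.
move=> hF; elim: s => [|i s IH].
  by have := ssol0; congr ssol; apply/funext => x; rewrite big_nil.
have := ssol_add (hF i) IH; congr ssol.
by apply/funext => x; rewrite big_cons.
Qed.

Lemma ssol_approx (sigma : R) m : 1/4 <= sigma -> sigma < 1/2 -> ssol (refine_iter sigma m).
Proof.
move=> s4 sh; elim: m => [|m IH]; first exact: ssol0.
by apply: ssol_sum => d; apply: ssol_block => //; lra.
Qed.

Lemma continuous_plane_lipschitz V (L : R) :
  (forall z w, `|V z - V w| <= L * `|z - w|) -> continuous V.
Proof.
move=> H x; apply/cvgrPdist_le => e e0; near=> y.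
apply: (le_trans (H x y)).
have hC : `|x - y| <= e / (`|L| + 1).
  near: y; apply: (@cvgr_dist_le R _ _ (nbhs x) _ id x) => //.
  by rewrite divr_gt0//; have := normr_ge0 L; lra.
have Cle := ler_norm L; have C0 := normr_ge0 L; have := normr_ge0 (x - y).
move: hC; rewrite ler_pdivlMr; last lra.
by move=> hC; nra.
Unshelve. all: by end_near.
Qed.

End scaled_solenoidal.

(** * The self-similar fields and their multi-scale sum *)

Section field.
Variable R : realType.

(** Images of 0 under compositions of the similarities [z -> corner d + s z]: the centers of the
    construction squares of the Cantor set, accumulating on it. *)
Definition word_point (s : R) (w : seq (bool * bool)) : R * R :=
  foldr (fun d z => corner R d + s *: z) 0 w.

Lemma norm_word_point (s : R) w : 0 < s -> s < 1/2 -> `|word_point s w| <= 1.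
Proof.
move=> s0 s1; elim: w => [|d w IH] /=; first by rewrite normr0.
apply: (le_trans (ler_normD _ _)); rewrite norm_corner prod_norm_scale (gtr0_norm s0).
by nra.
Qed.

Lemma self_similar_solenoidal (s : R) : 1/4 <= s -> s < 1/2 -> exists W : R * R -> R * R,
  [/\ unit_supp W, ssol W,
      exists L, 0 <= L /\ (forall z, `|W z| <= L) /\ (forall z w, `|W z - W w| <= L * `|z - w|)
    & forall w, W (word_point s w) = word_point s w].
Proof.
move=> s4 sh; have [W [W0 [L hL] W00 Wfun [C hC]]] := self_similar_field s4 sh.
have s0 : 0 < s by lra.
exists W; split => //.
- apply: ssol_uniform; first exact: (continuous_plane_lipschitz hL).
  move=> e e0.
  have [m hm] : exists m, C * s ^+ m <= e.
    apply: contrapT => h; have s1 : s < 1 by lra.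
    suff : e <= 0 by lra.
    apply: (@le_geometric_eq0 _ _ C s) => // m.
    by rewrite leNgt; apply/negP => hlt; apply: h; exists m; exact: ltW.
  exists (refine_iter s m); split; first exact: ssol_approx.
  by move=> x; exact: le_trans (hC m x) hm.
- exists `|L|; split => //; have Lle := ler_norm L; have L0 := normr_ge0 L.
  split => [z|z w]; last first.
    by apply: (le_trans (hL z w)); apply: ler_wpM2r.
  have [z1|z1] := lerP 1 `|z|; first by rewrite (W0 z z1) normr0.
  by have := hL z 0; rewrite W00 !subr0; have := normr_ge0 z; nra.
- elim=> [|d w IH] //=; rewrite Wfun ?IH//.
  exact: norm_word_point.
Qed.

End field.

(** The n-th copy sits in a square of half-width [q n / 8] about [(q n, 0)] with [q n = 2^-n]. Its
    Lipschitz constant is out of control as n grows, but its size is only [O(q n)], which suffices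
    at the origin; elsewhere finitely many copies count. *)
Lemma multi_scale_field (R : realType) (sg : nat -> R) :
  (forall n, 1/4 <= sg n /\ sg n < 1/2) ->
  exists (U : R * R -> R * R) (p : nat -> R * R) (kap : nat -> R),
  [/\ ssol U,
      exists C, 0 <= C /\ forall x, `|U x| <= C * `|x|,
      forall x, 2 <= `|x| -> U x = 0,
      forall d, 0 < d -> exists L, 0 <= L /\
        forall x y, d <= `|x| -> d <= `|y| -> `|U x - U y| <= L * `|x - y|
    & forall n, [/\ 0 < kap n, `|p n| + kap n <= 2 &
        forall w, U (p n + kap n *: word_point (sg n) w) =
                  p n + kap n *: word_point (sg n) w] ].
Proof.
move=> hsg.
have [W hW] := choice (fun n => self_similar_solenoidal (hsg n).1 (hsg n).2).
have [Lw hLw] : exists Lw : nat -> R, forall n, 0 <= Lw n /\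
    (forall z, `|W n z| <= Lw n) /\ (forall z w, `|W n z - W n w| <= Lw n * `|z - w|).
  have hL n : exists l : R, 0 <= l /\
      (forall z, `|W n z| <= l) /\ (forall z w, `|W n z - W n w| <= l * `|z - w|).
    by case: (hW n) => _ _ [L hL] _; exists L.
  by have [Lw h] := choice hL; exists Lw.
(* The outer bumps all have plateau radius 1/4, so that their constant [M] does not depend on n. *)
have t0 : (0 : R) < 1/4 by lra.
have t1 : (1/4 : R) < 1/2 by lra.
have [M [M0 [bM lM]]] := plateau_bounds t1.
pose q (n : nat) : R := (1/2) ^+ n.
have q0 n : 0 < q n by apply: exprn_gt0; lra.
have q1 n : q n <= 1 by apply: exprn_ile1; lra.
have qS n : q n.+1 = q n / 2 by rewrite /q exprS; field.
have qle m n : (m <= n)%N -> q n <= q m.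
  by move=> mn; apply: ler_wiXn2l => //; lra.
have qlt m n : (m < n)%N -> q n <= q m / 2 by move=> /qle; rewrite qS.
pose p n : R * R := (q n, 0).
pose r n : R := q n / 4.
(* Small enough both for the copy to fit into the plateau ([kap <= r / 4]) and for its values,
   bounded by [kap * Lw], to be at most [r], however large [Lw n] is. *)
pose kap n : R := r n / (4 * (1 + Lw n)).
have r0 n : 0 < r n by rewrite /r; have := q0 n; lra.
have k0 n : 0 < kap n by rewrite divr_gt0//; have [] := hLw n; lra.
have kE n : kap n * (4 * (1 + Lw n)) = r n.
  by rewrite /kap divfK//; have [] := hLw n; move=> ? _; apply/eqP; lra.
have kr n : kap n <= r n / 4 by have := kE n; have := k0 n; have [] := hLw n; nra.
have kL n : kap n * Lw n <= r n by have := kE n; have := k0 n; have [] := hLw n; nra.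
have np n : `|p n| = q n.
  by rewrite prod_normE /= normr0 gtr0_norm// max_l// ltW.
pose B n : R * R -> R * R := block (1/4) (p n) (r n) (kap n) (W n).
have Wsupp n : unit_supp (W n) by case: (hW n).
have Bout n x : q n / 8 <= `|x - p n| -> B n x = 0.
  move=> h; apply: block_out => //.
    by have := kr n; have := r0 n; lra.
  by move: h; rewrite /r; lra.
have Bbound n x : `|B n x| <= (M + 1) * q n.
  apply: (le_trans (block_bound _ _ _ bM (hLw n).2.1 _)) => //.
  by rewrite np; have := kL n; rewrite /r; have := q0 n; lra.
have Blip n : exists L, 0 <= L /\ forall x y, `|B n x - B n y| <= L * `|x - y|.
  exists (M * `|p n| / r n + Lw n); split; last first.
    exact: (block_lip _ _ _ lM (hLw n).2.2).
  apply: addr_ge0; last by case: (hLw n).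
  by apply: divr_ge0; [exact: mulr_ge0|exact: ltW].
have Bsol n : ssol (B n) by apply: ssol_block => //; case: (hW n).
have near_n n x : `|x - p n| < q n / 8 -> 7/8 * q n <= `|x| <= 9/8 * q n.
  move=> h; have := lerB_dist (p n) x; have := ler_normD (x - p n) (p n).
  rewrite subrK np distrC => h1 h2.
  by apply/andP; split; lra.
(* The annuli from [7/8 q n] to [9/8 q n] are disjoint, because [q] at least halves from one index
   to any later one. *)
have disj m n x : `|x - p m| < q m / 8 -> n != m -> B n x = 0.
  move=> hm nm; apply: Bout; rewrite leNgt; apply/negP => hn.
  have /andP[m1 m2] := near_n _ _ hm; have /andP[n1 n2] := near_n _ _ hn.
  case: (ltngtP n m) nm => // /qlt h _.
  - by have := q0 n; lra.
  - by have := q0 m; lra.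
(* No infinite sum is formed: [U x] is the value of the only block that may be nonzero at [x], with
   index 0 as a default where all vanish. *)
have pick x : exists v, exists n, v = B n x /\ forall m, m != n -> B m x = 0.
  case: (pselect (exists n, `|x - p n| < q n / 8)) => [[n hn]|hn].
    by exists (B n x), n; split=> // m mn; exact: disj hn mn.
  exists (B 0%N x), 0%N; split=> // m _; apply: Bout; rewrite leNgt; apply/negP => h.
  by apply: hn; exists m.
have [U hU] := choice pick.
have UE n x : `|x - p n| < q n / 8 -> U x = B n x.
  move=> hn; have [k [-> hk]] := hU x.
  have [->//|kn] := eqVneq k n.
  by rewrite (disj _ _ _ hn kn) hk// eq_sym.
have U_lin x : `|U x| <= 2 * (M + 1) * `|x|.
  have [n [-> hn]] := hU x.
  have [h|h] := lerP (q n / 8) `|x - p n|.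
    by rewrite Bout// normr0; apply: mulr_ge0 => //; lra.
  have /andP[h1 h2] := near_n _ _ h.
  apply: (le_trans (Bbound n x)); have := normr_ge0 x; have := q0 n.
  by nra.
pose S m x : R * R := \sum_(0 <= n < m) B n x.
have SE m x n : (forall k, k != n -> B k x = 0) -> S m x = if (n < m)%N then B n x else 0.
  move=> h; rewrite /S; case: ifPn => nm.
    rewrite big_mkord (bigD1 (Ordinal nm))//= big1 ?addr0// => i hi.
    by apply: h; apply: contraNneq hi => hi; apply/eqP/val_inj.
  rewrite big_nat big1// => i /andP[_ im]; apply: h.
  by apply: contraNneq nm => <-.
have Slip m : exists L, 0 <= L /\ forall x y, `|S m x - S m y| <= L * `|x - y|.
  elim: m => [|m [L [L0 hL]]].
    by exists 0; split=> // x y; rewrite /S !big_geq// subrr normr0 mul0r.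
  have [L' [L'0 hL']] := Blip m; exists (L + L'); split; first exact: addr_ge0.
  move=> x y; rewrite /S !big_nat_recr//= opprD addrACA mulrDl.
  by apply: (le_trans (ler_normD _ _)); apply: lerD; [exact: hL|exact: hL'].
have qsmall e : 0 < e -> exists m, q m <= e.
  move=> e0; apply: contrapT => h.
  suff : e <= 0 by lra.
  apply: (@le_geometric_eq0 _ _ 1 (1/2)); [lra|lra|move=> m].
  by rewrite mul1r leNgt; apply/negP => hlt; apply: h; exists m; exact: ltW.
have U_lip d : 0 < d -> exists L, 0 <= L /\
    forall x y, d <= `|x| -> d <= `|y| -> `|U x - U y| <= L * `|x - y|.
  move=> d0; have [|m hm] := qsmall (d / 2); first lra.
  (* Blocks of index at least [m] live in [|x| < 9/8 q m], below [d]; hence [U] is the partial sum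
     [S m] on [|x| >= d]. *)
  have [L [L0 hL]] := Slip m; exists L; split=> //.
  suff US x : d <= `|x| -> U x = S m x by move=> x y hx hy; rewrite !US.
  move=> dx; have [n [-> hn]] := hU x; rewrite (SE m x n hn).
  case: ifPn => //; rewrite -leqNgt => /qle mn.
  apply: Bout; rewrite leNgt; apply/negP => h.
  by have /andP[h1 h2] := near_n _ _ h; have := q0 n; lra.
(* At the origin continuity comes from the linear bound, elsewhere from the local Lipschitz
   bound. *)
have cU : continuous U.
  move=> x; have [x0|x0] := eqVneq x 0.
    have U0 : U 0 = 0 by apply/eqP; rewrite -normr_le0; have := U_lin 0; rewrite normr0 mulr0.
    have C0 : 0 < 2 * (M + 1) by lra.
    apply/cvgrPdist_le => e e0; near=> y; rewrite x0 U0 sub0r normrN.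
    apply: (le_trans (U_lin y)).
    have hy : `|x - y| <= e / (2 * (M + 1)).
      by near: y; apply: (@cvgr_dist_le R _ _ (nbhs x) _ id x) => //; rewrite divr_gt0//.
    rewrite mulrC -ler_pdivlMr//.
    have <- : `|x - y| = `|y| by rewrite x0 sub0r normrN.
    exact: hy.
  have x1 : 0 < `|x| by rewrite normr_gt0.
  have [L [L0 hL]] := U_lip (`|x| / 2) (divr_gt0 x1 (ltr0n R 2)).
  apply/cvgrPdist_le => e e0; near=> y.
  have yx : `|x| / 2 <= `|y|.
    have : `|x - y| <= `|x| / 2.
      by near: y; apply: (@cvgr_dist_le R _ _ (nbhs x) _ id x) => //; rewrite divr_gt0//.
    have := lerB_dist x (x - y); rewrite opprB addrCA subrr addr0; lra.
  apply: (le_trans (hL x y _ yx)); first lra.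
  have : `|x - y| <= e / (L + 1).
    by near: y; apply: (@cvgr_dist_le R _ _ (nbhs x) _ id x) => //; rewrite divr_gt0//; lra.
  rewrite ler_pdivlMr; last lra.
  by have := normr_ge0 (x - y); nra.
exists U, p, kap; split.
(* The partial sums converge uniformly: the tail is at most [(M + 1) q m]. *)
- apply: ssol_uniform => // e e0.
  have [|m hm] := qsmall (e / (M + 1)); first by rewrite divr_gt0//; lra.
  exists (S m); split; first by apply: ssol_sum.
  move=> x; have [n [-> hn]] := hU x; rewrite (SE m x n hn); case: ifPn => nm.
    by rewrite subrr normr0 ltW.
  rewrite sub0r normrN; apply: (le_trans (Bbound n x)).
  move: nm; rewrite -leqNgt => /qle mn.
  by move: hm; rewrite ler_pdivlMr; [nra|lra].
- by exists (2 * (M + 1)); split => //; lra.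
- move=> x x2; have [n [-> hn]] := hU x; apply: Bout; rewrite leNgt; apply/negP => h.
  by have /andP[h1 h2] := near_n _ _ h; have := q1 n; lra.
- exact: U_lip.
- move=> n; split=> //; first by rewrite np; have := q1 n; have := kr n; rewrite /r; lra.
  move=> w; have [s4 sh] := hsg n.
  have nw : `|word_point (sg n) w| <= 1 by apply: norm_word_point; lra.
  set z := word_point _ _ in nw *.
  have e : p n + kap n *: z - p n = kap n *: z by rewrite addrAC subrr add0r.
  have ez : `|kap n *: z| <= kap n.
    by rewrite prod_norm_scale gtr0_norm//; have := k0 n; nra.
  have := k0 n; have := kr n; have := q0 n => qn krn kn.
  have rq : r n = q n / 4 by [].
  rewrite (UE n); last by rewrite e; lra.
  rewrite /B block_in//; last by rewrite e; lra.
  rewrite e scalerA mulVf ?scale1r; last by apply/eqP; lra.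
  by case: (hW n) => _ _ _ ->.
Unshelve. all: by end_near.
Qed.

(** * Comparison of the Euclidean distance with the max norm *)

Section euclidean.
Variable R : realType.
Implicit Types x y : R * R.

Lemma norm_le_eucl x y : `|x - y| <= eucl x y.
Proof.
rewrite plane_norm_le /= /eucl; apply/andP; split; rewrite -sqrtr_sqr;
by rewrite ler_wsqrtr// ?lerDl ?lerDr sqr_ge0.
Qed.

Lemma eucl_le_norm x y : eucl x y <= 2 * `|x - y|.
Proof.
have h1 := @plane_coord1 R (x - y); have h2 := @plane_coord2 R (x - y).
have h := normr_ge0 (x - y).
rewrite -[leRHS]ger0_norm ?mulr_ge0// -sqrtr_sqr /eucl ler_wsqrtr//.
rewrite /= in h1 h2.
have e1 : (x.1 - y.1) ^+ 2 <= `|x - y| ^+ 2 by rewrite -[leLHS]real_normK ?num_real// lerXn2r// nnegrE.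
have e2 : (x.2 - y.2) ^+ 2 <= `|x - y| ^+ 2 by rewrite -[leLHS]real_normK ?num_real// lerXn2r// nnegrE.
by rewrite exprMn; have := sqr_ge0 `|x - y|; lra.
Qed.

Lemma enormE x : enorm x = eucl x 0.
Proof. by rewrite /enorm /eucl !subr0. Qed.

Lemma eucl_ge0 x y : 0 <= eucl x y.
Proof. exact: sqrtr_ge0. Qed.

End euclidean.

Lemma lam_ge_sqr (R : realType) (a t : R) : 0 <= a -> a <= t -> a <= 1 -> a ^+ 2 / 2 <= lam t.
Proof.
move=> a0 at0 a1; rewrite /lam.
case: (pos_cases t) => -[-> ?]; case: (pos_cases (t - 1/2)) => -[-> ?];
  by case: (pos_cases (t - 1)) => -[-> ?]; nra.
Qed.

(** * Regularity of the time-dependent velocity *)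

Section velocity.
Variables (R : realType) (U : R * R -> R * R) (C : R).
Hypotheses (C0 : 0 <= C) (U_lin : forall x, `|U x| <= C * `|x|).
Hypothesis U_supp : forall x, 2 <= `|x| -> U x = 0.
Hypothesis U_lip : forall d, 0 < d -> exists L, 0 <= L /\
  forall x y, d <= `|x| -> d <= `|y| -> `|U x - U y| <= L * `|x - y|.
Hypothesis U_sol : ssol U.
Implicit Types (t s : R) (x y : R * R).

(** For [t <= 0] the inverse of [lam t = 0] is 0 by convention, but the factor [dlam t] vanishes, so
    the velocity is 0. *)
Definition velocity t x : R * R := dlam t *: U ((lam t)^-1 *: x).

Lemma velocity_far t x : 2 <= `|x| -> velocity t x = 0.
Proof.
move=> x2; rewrite /velocity; have [t0|t0] := lerP t 0; first by rewrite dlam_le0// scale0r.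
have l0 := lam_gt0 t0; rewrite U_supp ?scaler0// norm_scale_inv// ler_pdivlMr//.
by have := lam_le1 t; lra.
Qed.

Let U_bound x : `|U x| <= 2 * C.
Proof.
have [h|h] := lerP 2 `|x|; first by rewrite U_supp// normr0; have := C0; lra.
by apply: (le_trans (U_lin x)); have := C0; nra.
Qed.

Lemma velocity_lip d : 0 < d -> exists L, 0 <= L /\ forall t s x y,
  d <= `|x| -> d <= `|y| -> `|velocity t x - velocity s y| <= L * (`|t - s| + `|x - y|).
Proof.
(* On [|x| >= d], replacing [lam] by [m] changes nothing: if [lam t <= d/2], dividing [x] by either
   gives norm at least 2, where [U] vanishes (or [t <= 0] and [dlam t = 0]). Unlike [lam], [m] stays
   away from 0, so its inverse is Lipschitz. *)
move=> d0; pose m t := Num.max (lam t) (d / 2).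
have m1 t : d / 2 <= m t by rewrite le_max lexx orbT.
have m2 t : m t <= 1 + d by rewrite ge_max; have := lam_le1 t; move=> ?; apply/andP; split; lra.
have m0 t : 0 < m t by have := m1 t; lra.
have m_lip t s : `|m t - m s| <= 2 * `|t - s|.
  have := @lam_lip R t s; rewrite /m !ler_norml => /andP[h1 h2].
  have := normr_ge0 (t - s) => h3.
  by case: (lerP (lam t) (d / 2)) => ?; case: (lerP (lam s) (d / 2)) => ?; apply/andP; split; lra.
have velE t x : d <= `|x| -> velocity t x = dlam t *: U ((m t)^-1 *: x).
  move=> dx; rewrite /velocity /m; case: (lerP (lam t) (d / 2)) => // h.
  have [t0|t0] := lerP t 0; first by rewrite dlam_le0// !scale0r.
  have l0 := lam_gt0 t0; rewrite !U_supp//.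
    by rewrite norm_scale_inv ?ler_pdivlMr//; lra.
  by rewrite norm_scale_inv ?ler_pdivlMr//; lra.
have d1 : 0 < 1 + d by lra.
(* Since [m <= 1 + d], the rescaled points keep distance [d / (1 + d)] from the origin. *)
have [L [L0 hL]] := U_lip (divr_gt0 d0 d1).
have low t x : d <= `|x| -> d / (1 + d) <= `|(m t)^-1 *: x|.
  move=> dx; rewrite norm_scale_inv//; apply: ler_pM => //; first exact: ltW.
    by rewrite invr_ge0 ltW.
  by rewrite lef_pV2 ?posrE.
pose K := 2 * (1 + d).
pose A := 2 / d; pose D := K * (A * A * 2).
have A0 : 0 < A by rewrite divr_gt0.
have K0 : 0 < K by rewrite /K; lra.
have D0 : 0 <= D by apply/ltW/mulr_gt0 => //; apply: mulr_gt0 => //; exact: mulr_gt0.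
have mA t : (m t)^-1 <= A.
  by rewrite /A -[2 / d]invrK lef_pV2 ?posrE// ?invr_gt0// invf_div.
have main t s x y : d <= `|x| -> d <= `|y| -> `|y| <= K ->
    `|U ((m t)^-1 *: x) - U ((m s)^-1 *: y)| <= L * (A + D) * (`|t - s| + `|x - y|).
  move=> dx dy yK; apply: (le_trans (hL _ _ (low t x dx) (low s y dy))).
  rewrite -mulrA ler_wpM2l//.
  have -> : (m t)^-1 *: x - (m s)^-1 *: y = (m t)^-1 *: (x - y) + ((m t)^-1 - (m s)^-1) *: y.
    by rewrite scalerBr scalerBl addrA subrK.
  apply: (le_trans (ler_normD _ _)); rewrite !prod_norm_scale.
  have i1 : 0 < (m t)^-1 by rewrite invr_gt0.
  have i2 : 0 < (m s)^-1 by rewrite invr_gt0.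
  rewrite (gtr0_norm i1).
  have e1 : (m t)^-1 * `|x - y| <= A * `|x - y| by rewrite ler_wpM2r.
  have e2 : `|(m t)^-1 - (m s)^-1| <= A * A * (2 * `|t - s|).
    have -> : (m t)^-1 - (m s)^-1 = (m t)^-1 * (m s)^-1 * (m s - m t).
      by field; rewrite !gt_eqF.
    rewrite normrM (distrC (m s)) ler_pM//; last first.
    by rewrite normrM !gtr0_norm//; apply: ler_pM => //; exact: ltW.
  have e3 : `|(m t)^-1 - (m s)^-1| * `|y| <= A * A * (2 * `|t - s|) * K by rewrite ler_pM.
  have := normr_ge0 (t - s); have := normr_ge0 (x - y) => xy0 ts0.
  have a1 := mulr_ge0 (ltW A0) ts0; have a2 := mulr_ge0 D0 xy0.
  have a3 : A * A * (2 * `|t - s|) * K = D * `|t - s| by rewrite /D; ring.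
  by rewrite a3 in e3; nra.
(* If only [y] lies beyond [K], the two points are swapped; if both do, the rescaled points have
   norm at least 2 and [U] vanishes at both. *)
have main' t s x y : d <= `|x| -> d <= `|y| ->
    `|U ((m t)^-1 *: x) - U ((m s)^-1 *: y)| <= L * (A + D) * (`|t - s| + `|x - y|).
  move=> dx dy; have [yK|yK] := lerP `|y| K; first exact: main.
  have [xK|xK] := lerP `|x| K.
    by rewrite distrC (distrC t) (distrC x); exact: main.
  have z r v : K < `|v| -> U ((m r)^-1 *: v) = 0.
    move=> h; rewrite U_supp// norm_scale_inv// ler_pdivlMr//.
    by have := m2 r; move: h; rewrite /K; lra.
  rewrite !z// subrr normr0; apply: mulr_ge0; last exact: addr_ge0.
  by apply: mulr_ge0 => //; lra.
exists (32 * C + 2 * (L * (A + D))); split.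
  have := C0; have : 0 <= L * (A + D) by apply: mulr_ge0 => //; lra.
  by lra.
move=> t s x y dx dy; rewrite !velE//.
set a := U _; set b := U _.
have -> : dlam t *: a - dlam s *: b = (dlam t - dlam s) *: a + dlam s *: (a - b).
  by rewrite scalerBl scalerBr addrA subrK.
apply: (le_trans (ler_normD _ _)); rewrite !prod_norm_scale.
have h1 : `|dlam t - dlam s| * `|a| <= 16 * `|t - s| * (2 * C).
  by apply: ler_pM => //; [exact: dlam_lip|exact: U_bound].
have h2 : `|dlam s| * `|a - b| <= 2 * (L * (A + D) * (`|t - s| + `|x - y|)).
  apply: ler_pM => //; last exact: main'.
  by rewrite ger0_norm ?dlam_ge0// dlam_le2.
have := mulr_ge0 C0 (normr_ge0 (x - y)).
by lra.
Qed.

(** Two regimes, uniformly in time: up to time [a] the factor [dlam t <= 4 t] is small and [U]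
    bounded by [2 C]; after it [lam t >= a^2 / 2], so the linear bound on [U] makes the velocity at
    most a multiple of [|x|]. *)
Lemma velocity_small e : 0 < e -> exists d, 0 < d /\
  forall t x, `|x| <= d -> `|velocity t x| <= e.
Proof.
move=> e0; have C8 : 0 < 8 * C + 1 by have := C0; lra.
pose a := Num.min 1 (e / (8 * C + 1)).
have a0 : 0 < a by rewrite lt_min ltr01 divr_gt0.
have a1 : a <= 1 by rewrite ge_min lexx.
have ae : a * (8 * C + 1) <= e.
  by rewrite -ler_pdivlMr// ge_min lexx orbT.
pose l := a ^+ 2 / 2.
have l0 : 0 < l by rewrite /l divr_gt0// exprn_gt0.
have C2 : 0 < 2 * C + 1 by have := C0; lra.
exists (e * l / (2 * C + 1)); split; first by rewrite divr_gt0// mulr_gt0.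
move=> t x; rewrite ler_pdivlMr// => hx.
rewrite /velocity prod_norm_scale ger0_norm ?dlam_ge0//.
have [t0|t0] := lerP t 0; first by rewrite dlam_le0// mul0r ltW.
have Cn := C0.
have [ta|ta] := lerP t a.
  apply: (@le_trans _ _ (4 * t * (2 * C))); last by nra.
  by apply: ler_pM => //; [exact: dlam_ge0|exact: dlam_le (ltW t0)].
have lt : l <= lam t by apply: lam_ge_sqr => //; exact: ltW.
have lt0 : 0 < lam t by lra.
apply: (@le_trans _ _ (2 * (C * (`|x| / l)))).
  apply: ler_pM; rewrite ?dlam_ge0 ?dlam_le2//.
  apply: (le_trans (U_lin _)); rewrite ler_wpM2l// norm_scale_inv// ler_wpM2l//.
  by rewrite lef_pV2 ?posrE.
have -> : 2 * (C * (`|x| / l)) = (2 * C * `|x|) / l by ring.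
by rewrite ler_pdivrMr//; have := normr_ge0 x; nra.
Qed.

(** Points closer than [d1 / 2] are either both within [d1] of the origin, where both values are
    small, or both at distance at least [d1 / 2] from it, where the Lipschitz bound applies. *)
Lemma velocity_uniformly_continuous e : 0 < e -> exists2 d, 0 < d &
  forall t s x y, `|t - s| < d -> `|x - y| < d -> `|velocity t x - velocity s y| < e.
Proof.
move=> e0; have e4 : 0 < e / 4 by lra.
have [d1 [d10 h1]] := velocity_small e4.
have d12 : 0 < d1 / 2 by lra.
have [L [L0 h2]] := velocity_lip d12.
have L1 : 0 < 4 * (L + 1) by lra.
exists (Num.min (d1 / 2) (e / (4 * (L + 1)))); first by rewrite lt_min d12 divr_gt0.
move=> t s x y; rewrite !lt_min => /andP[_ ts] /andP[xy1 xy2].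
move: ts xy2; rewrite !ltr_pdivlMr// => ts xy2.
have near0 : `|x| <= d1 -> `|y| <= d1 -> `|velocity t x - velocity s y| < e.
  move=> hx hy; apply: (le_lt_trans (ler_normB _ _)).
  by have := h1 t x hx; have := h1 s y hy; lra.
have := lerB_dist x y; have := lerB_dist y x; rewrite (distrC y) => yx yx'.
have far0 : d1 / 2 <= `|x| -> d1 / 2 <= `|y| -> `|velocity t x - velocity s y| < e.
  move=> hx hy; apply: (le_lt_trans (h2 _ _ _ _ hx hy)).
  by have := normr_ge0 (t - s); have := normr_ge0 (x - y); nra.
have [hx|hx] := lerP (d1 / 2) `|x|; have [hy|hy] := lerP (d1 / 2) `|y|.
- exact: far0.
- by apply: near0; lra.
- by apply: near0; lra.
- by apply: near0; lra.
Qed.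

Lemma velocity_continuous t : continuous (velocity t).
Proof.
move=> x; apply/cvgrPdist_lt => e e0.
have [d d0 h] := velocity_uniformly_continuous e0.
near=> y; apply: h; first by rewrite subrr normr0.
by near: y; apply: (@cvgr_dist_lt R _ _ (nbhs x) _ id x).
Unshelve. all: by end_near.
Qed.

Lemma velocity_weakly_div_free : weakly_div_free velocity.
Proof.
move=> t _ psi tp; suff : solenoidal (velocity t) by case=> _ /(_ psi tp).
have [t0|t0] := lerP t 0.
  have := @ssol0 R 1 0 1 ltr01; congr solenoidal; apply/funext => x.
  by rewrite /velocity dlam_le0// scale0r scaler0.
have := U_sol (dlam t) 0 (lam_gt0 t0); congr solenoidal.
by apply/funext => x; rewrite subr0.
Qed.

End velocity.

(** * Base-4 coding of the Cantor set *)

Section coding.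
Variables (R : realType) (s : R).
Hypotheses (s4 : 1/4 <= s) (sh : s < 1/2).
Implicit Types y : R.

Definition bitR (b : bool) : R := if b then 1 else 0.
(** The leading base-4 digit of a number in [[0, 1)], given as two binary digits so that it names a
    corner. *)
Definition digit y : bool * bool := (1/2 <= y, 1/2 <= 2 * y - bitR (1/2 <= y)).
Definition shift4 y : R := 4 * y - (2 * bitR (digit y).1 + bitR (digit y).2).
Fixpoint digits (m : nat) y : seq (bool * bool) :=
  if m is m'.+1 then digit y :: digits m' (shift4 y) else [::].

Lemma shift4_itv y : 0 <= y < 1 -> 0 <= shift4 y < 1.
Proof.
case/andP=> y0 y1; rewrite /shift4 /digit /=.
case: (lerP (1/2) y) => h; rewrite /bitR; [case: (lerP (1/2) (2 * y - 1)) => h'|case: (lerP (1/2) (2 * y - 0)) => h'];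
by apply/andP; split; lra.
Qed.

Let s0 : 0 < s. Proof. by have := s4; lra. Qed.
Let s1 : s < 1. Proof. by have := sh; lra. Qed.

Let wp m y := word_point s (digits m y).

Lemma word_point_cauchy m y : `|wp m.+1 y - wp m y| <= 1 * s ^+ m.
Proof.
elim: m y => [|m IH] y.
  by rewrite /wp /= scaler0 addr0 subr0 norm_corner mul1r expr0; lra.
rewrite /wp [digits m.+2 y]/= [digits m.+1 y]/= [word_point _ _]/= [X in _ - X]/=.
rewrite opprD addrACA subrr add0r -scalerBr prod_norm_scale (gtr0_norm s0) exprS mulrCA.
by rewrite ler_pM2l; [exact: IH|exact: s0].
Qed.

Lemma corner_dist d d' : d != d' -> 1 <= `|corner R d - corner R d'|.
Proof.
have h : `|1/2 + 1/2 : R| = 1 by rewrite ger0_norm; lra.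
have h' : `|- (1/2) - 1/2 : R| = 1 by rewrite ler0_norm; lra.
rewrite plane_norm_ge; case: d d' => [[] []] [[] []] //= _;
by rewrite /sgh ?opprK ?h ?h' ?lexx ?orbT.
Qed.

(** Numbers [4^-m] apart disagree within their first [m] digits. At the first disagreement the
    corners are at distance at least 1 and the remaining words move each point by at most [s],
    leaving a gap [1 - 2 s], scaled by [s] for each common digit. *)
Lemma word_point_sep m k y y' : 0 <= y < 1 -> 0 <= y' < 1 -> (m <= k)%N ->
  (1/4) ^+ m <= `|y - y'| -> (1 - 2 * s) * s ^+ m <= `|wp k y - wp k y'|.
Proof.
elim: m k y y' => [|m IH] k y y' hy hy' mk.
  rewrite expr0 => h; exfalso; case/andP: hy => ? ?; case/andP: hy' => ? ?.
  by move: h; rewrite ler_normr => /orP[] ?; lra.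
case: k mk => // k mk h.
have p0 : 0 < 1 - 2 * s by have := sh; lra.
have w1 z : `|word_point s z| <= 1 by apply: norm_word_point.
rewrite /wp /=; have [e|ne] := eqVneq (digit y) (digit y').
  rewrite e opprD addrACA subrr add0r -scalerBr prod_norm_scale (gtr0_norm s0).
  rewrite exprS mulrCA ler_pM2l//; apply: IH => //; [exact: shift4_itv..|].
  have -> : shift4 y - shift4 y' = 4 * (y - y') by rewrite /shift4 e; ring.
  by rewrite normrM (ger0_norm (ler0n R 4)); move: h; rewrite exprS; lra.
have := corner_dist ne.
set c := corner R _; set c' := corner R _; set a := word_point _ _; set b := word_point _ _.
have := ler_normD (c + s *: a - (c' + s *: b)) (s *: b - s *: a).
have alg (u v z w : R * R) : u + v - (z + w) + (w - v) = u - z by apply: plane_eq => /=; ring.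
rewrite alg {alg}.
have := ler_normB (s *: b) (s *: a); rewrite !prod_norm_scale (gtr0_norm s0).
have ha : `|a| <= 1 by exact: w1.
have hb : `|b| <= 1 by exact: w1.
have sm : s ^+ m.+1 <= 1 by rewrite exprn_ile1// ltW.
by have := s0; nra.
Qed.

(** [G y] is the limit of the word points along the digits of [y]. The inverse of the coding is
    Hoelder with exponent [a], since distances [4^-m] upstairs become at least a multiple of [s^m]
    and [s^a = 1/4]. *)
Lemma hoelder_coding (a : R) : s `^ a = 1/4 -> 0 < a -> exists (G : R -> R * R) (A : R),
  [/\ 0 < A,
    forall y e, 0 < e -> exists w, `|word_point s w - G y| <= e
  & forall y y', 0 <= y < 1 -> 0 <= y' < 1 -> `|y - y'| <= A * `|G y - G y'| `^ a].
Proof.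
move=> sa a0.
pose K := 1 / (1 - s).
have lims y : exists l : R * R, forall m, `|wp m y - l| <= K * s ^+ m.
  have hc m := word_point_cauchy m y.
  have [l1 h1] := @geometric_limit R (fun m => (wp m y).1) 1 s s0 s1
    (fun m => le_trans (plane_coord1 _) (hc m)).
  have [l2 h2] := @geometric_limit R (fun m => (wp m y).2) 1 s s0 s1
    (fun m => le_trans (plane_coord2 _) (hc m)).
  by exists (l1, l2) => m; rewrite plane_norm_le; apply/andP; split; [exact: h1|exact: h2].
have [G hG] := choice lims.
have p0 : 0 < 1 - 2 * s by have := sh; lra.
have Gsep m y y' : 0 <= y < 1 -> 0 <= y' < 1 -> (1/4) ^+ m <= `|y - y'| ->
    (1 - 2 * s) * s ^+ m <= `|G y - G y'|.
  move=> hy hy' h; rewrite -subr_le0.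
  apply: (@le_geometric_eq0 _ _ (2 * K * s ^+ m) s s0 s1) => k.
  have := word_point_sep hy hy' (leq_addr k m) h.
  have := hG y (m + k)%N; have := hG y' (m + k)%N.
  have -> : 2 * K * s ^+ m * s ^+ k = 2 * (K * s ^+ (m + k)) by rewrite exprD; ring.
  move: (K * _) (wp _ y) (wp _ y') => B u v h1 h2 h3.
  have := ler_normD (u - G y) (G y - G y' + (G y' - v)).
  have := ler_normD (G y - G y') (G y' - v).
  by rewrite !addrA !subrK (distrC (G y') v); lra.
exists G, (4 * ((1 - 2 * s)^-1) `^ a); split.
- by rewrite mulr_gt0// powR_gt0// invr_gt0.
- move=> y e e0; apply: contrapT => h; suff : e <= 0 by lra.
  apply: (@le_geometric_eq0 _ _ K s s0 s1) => m.
  apply: le_trans (hG y m); rewrite leNgt; apply/negP => hlt; apply: h.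
  by exists (digits m y); exact: ltW.
move=> y y' hy hy'; have [->|yy'] := eqVneq y y'.
  by rewrite subrr normr0 mulr_ge0 ?powR_ge0// mulr_ge0// powR_ge0.
have yp : 0 < `|y - y'| by rewrite normr_gt0 subr_eq0.
have [m0 hm0] : exists m, (1/4) ^+ m <= `|y - y'|.
  apply: contrapT => h; suff : `|y - y'| <= 0 by lra.
  apply: (@le_geometric_eq0 _ _ 1 (1/4)); [lra|lra|move=> m].
  by rewrite mul1r leNgt; apply/negP => hlt; apply: h; exists m; exact: ltW.
have ex : exists m, (1/4 : R) ^+ m <= `|y - y'| by exists m0.
(* The least exponent is used, so its predecessor bounds [|y - y'|] from above; this costs the
   factor 4 in the constant. *)
case: (ex_minnP ex) => -[|m] hm mmin.
  exfalso; case/andP: hy => ? ?; case/andP: hy' => ? ?.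
  by move: hm; rewrite expr0 ler_normr => /orP[] ?; lra.
have hlt : `|y - y'| <= (1/4) ^+ m.
  by rewrite leNgt; apply/negP => /ltW /mmin; rewrite ltnn.
apply: (le_trans hlt).
have := Gsep _ _ _ hy hy' hm.
rewrite mulrC -ler_pdivlMr// => hG'.
have pw : (s ^+ m.+1) `^ a = (1/4) ^+ m.+1.
  elim: (m.+1) => [|k IH]; first by rewrite !expr0 powR1.
  by rewrite !exprS powRM ?exprn_ge0 ?(ltW s0)// IH sa.
rewrite -mulrA -powRM ?invr_ge0// ?(ltW p0)//.
have -> : (1/4) ^+ m = 4 * (1/4) ^+ m.+1 :> R by rewrite exprS; field.
rewrite ler_pM2l// -pw; apply: ge0_ler_powR.
- exact: ltW.
- by rewrite nnegrE exprn_ge0// ltW.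
- by rewrite nnegrE mulr_ge0// invr_ge0 ltW.
- by rewrite mulrC.
Qed.

End coding.

(** The solution is [(1/4)^(1/a)]; [a < 2] puts it below 1/2 and [a >= 1] keeps it at least 1/4. *)
Lemma ratio_of_dimension (R : realType) (a : R) : 1 <= a -> a < 2 ->
  exists s : R, [/\ 1/4 <= s, s < 1/2 & s `^ a = 1/4].
Proof.
move=> a1 a2; pose l : R := ln (1/2).
have h2 : (0 : R) < 1/2 by lra.
have l0 : l < 0 by apply: ln_lt0; apply/andP; split; lra.
have el : expR l = 1/2 by rewrite lnK// posrE.
have e4 : expR (2 * l) = 1/4.
  have -> : 2 * l = l + l by ring.
  by rewrite expRD el; field.
have b1 : 2 * l <= 2 * l / a by rewrite ler_pdivlMr; [nra|lra].
have b2 : 2 * l / a < l by rewrite ltr_pdivrMr; [nra|lra].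
exists (expR (2 * l / a)); split.
- by rewrite -e4 ler_expR.
- by rewrite -el ltr_expR.
- by rewrite -expRM divfK ?e4//; apply/eqP; lra.
Qed.

(** * Bounds on Hausdorff measure and dimension *)

Section hausdorff.
Variable R : realType.
Implicit Types (U K : set (R * R)) (s d : R).

Lemma hcost_ge0 s U : (0 <= hcost s U)%E.
Proof. by rewrite /hcost; case: pselect => ? //; rewrite lee_fin powR_ge0. Qed.

Lemma eucl_le_ediam U d x y : (ediam U <= d%:E)%E -> U x -> U y ->
  eucl x y <= fine (ediam U) <= d.
Proof.
move=> Ud Ux Uy.
have h : ((eucl x y)%:E <= ediam U)%E by apply: ereal_sup_ubound; exists x, y.
have f : ediam U \is a fin_num.
  by rewrite fin_numElt (lt_le_trans (ltNyr _) h) (le_lt_trans Ud (ltry _)).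
by rewrite -!lee_fin fineK// h.
Qed.

Lemma nneseries_le (u : nat -> \bar R) (c : \bar R) : (forall i, 0 <= u i)%E ->
  (forall n, \sum_(0 <= i < n) u i <= c)%E -> (\sum_(i <oo) u i <= c)%E.
Proof.
move=> u0 h; apply: lime_le; first by apply: is_cvg_nneseries => n _ _; exact: u0.
by apply: nearW => n; exact: h.
Qed.

(** A cover of [K] pulls back to a cover of [[0, 1)] by intervals whose lengths are at most [C]
    times the costs; total length at least 1 then bounds the total cost below by [1/C]. *)
Lemma hausdorff_gt0 K (b : R * R) (rho s a A : R) (G : R -> R * R) :
  0 < rho -> 0 < A -> 0 <= s -> s <= a -> 0 < a ->
  (forall y, 0 <= y < 1 -> K (b + rho *: G y)) ->
  (forall y y', 0 <= y < 1 -> 0 <= y' < 1 -> `|y - y'| <= A * `|G y - G y'| `^ a) ->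
  hausdorff s K <> 0%E.
Proof.
move=> rho0 A0 s0 sa a0 KG hG.
pose C : R := 2 * (A * (rho^-1) `^ a).
have C0 : 0 < C by rewrite /C !mulr_gt0// powR_gt0// invr_gt0.
suff h : ((C^-1)%:E <= hausdorff s K)%E.
  move=> h0; move: h; rewrite h0 lee_fin leNgt invr_gt0 C0//.
(* One scale suffices under the supremum; scale 1 makes all diameters [d <= 1], whence [d^a <= d^s]
   for [s <= a]. *)
apply: (@le_trans _ _ (hausdorff_delta s 1 K)); last first.
  by apply: ereal_sup_ubound; exists 1 => /=; rewrite ?ltr01.
apply: le_ereal_inf_tmp => _ [U [KU U1] <-].
(* An interval about one point of the preimage replaces the preimage itself, which need not be
   measurable. *)
have sig i : exists J : set R, [/\ measurable J,
    (lebesgue_measure J <= C%:E * hcost s (U i))%E &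
    forall y, 0 <= y < 1 -> U i (b + rho *: G y) -> J y].
  case: (pselect (exists y, 0 <= y < 1 /\ U i (b + rho *: G y))) => [[y0 [hy0 Uy0]]|no]; last first.
    exists set0; split=> //.
      by rewrite measure0; apply: mule_ge0; [rewrite lee_fin ltW|exact: hcost_ge0].
    by move=> y hy Uy; apply: no; exists y.
  have /andP[d0 d1] := eucl_le_ediam (U1 i) Uy0 Uy0.
  set d := fine (ediam (U i)) in d0 d1 *.
  have d0' : 0 <= d by apply: le_trans d0; exact: eucl_ge0.
  pose D : R := A * (rho^-1) `^ a * d `^ s.
  exists `[y0 - D, y0 + D]; split.
  - exact: measurable_itv.
  - have -> : hcost s (U i) = (d `^ s)%:E.
      by rewrite /hcost; case: pselect => // U0; exfalso; move: Uy0; rewrite U0.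
    have D0 : 0 <= D by apply: mulr_ge0; [apply: mulr_ge0; [exact: ltW|exact: powR_ge0]|exact: powR_ge0].
    rewrite lebesgue_measure_itv/= lte_fin; case: ifP => _; last first.
      by rewrite -EFinM lee_fin; apply: mulr_ge0; [exact: ltW|exact: powR_ge0].
    by rewrite -EFinD -EFinM lee_fin /C; rewrite /D; lra.
  move=> y hy Uy; rewrite /= in_itv /=.
  have /andP[e1 _] := eucl_le_ediam (U1 i) Uy0 Uy.
  suff : `|y0 - y| <= D by rewrite ler_norml => /andP[? ?]; apply/andP; split; lra.
  apply: (le_trans (hG _ _ hy0 hy)).
  rewrite /D -mulrA ler_pM2l//.
  have n1 : `|G y0 - G y| <= rho^-1 * d.
    rewrite ler_pdivlMl//; apply: le_trans e1; apply: le_trans (norm_le_eucl _ _).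
    by rewrite opprD addrACA subrr add0r -scalerBr prod_norm_scale gtr0_norm.
  apply: (@le_trans _ _ ((rho^-1 * d) `^ a)).
    by apply: ge0_ler_powR; rewrite ?nnegrE ?mulr_ge0// ?invr_ge0 ltW.
  rewrite powRM ?invr_ge0 ?(ltW rho0)// ler_wpM2l ?powR_ge0//.
  have [->|dn] := eqVneq d 0; first by rewrite powR0 ?powR_ge0// gt_eqF.
  have dp : 0 < d by rewrite lt_neqAle eq_sym dn.
  rewrite /powR (gt_eqF dp) ler_expR; have : ln d <= 0 by apply: ln_le0.
  by move=> ?; nra.
have [J hJ] := choice sig.
have cov : (lebesgue_measure (`[0%R, 1%R[%classic : set R) <= \sum_(i <oo) lebesgue_measure (J i))%E.
  apply: measure_sigma_subadditive.
  - by move=> i; case: (hJ i).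
  - exact: measurable_itv.
  - move=> y; rewrite /= in_itv /= => hy.
    by have [i _ Ui] := KU _ (KG y hy); exists i => //; case: (hJ i) => _ _; apply.
rewrite lebesgue_measure_itv/= lte_fin ltr01 oppr0 adde0 in cov.
rewrite -(@lee_pmul2l _ C%:E) ?lte_fin// -EFinM divff ?gt_eqF//.
rewrite -nneseriesZl; last by move=> i _; exact: hcost_ge0.
by apply: (le_trans cov); apply: lee_nneseries => // i _; case: (hJ i).
Qed.

Lemma hausdorff_delta_ge0 s d K : (0 <= hausdorff_delta s d K)%E.
Proof.
apply: le_ereal_inf_tmp => _ [U _ <-]; apply: nneseries_ge0 => n _ _; exact: hcost_ge0.
Qed.

(** A grid of [N^2] squares of side [h = 2 M / N] has total cost at most
    [N^2 (2 h)^s = (4 M)^s N^(2 - s)], which tends to 0. *)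
Lemma hausdorff_bounded K (M s : R) : 0 < M -> 2 < s ->
  (forall x, K x -> `|x| < M) -> hausdorff s K = 0%E.
Proof.
move=> M0 s2 KM.
have main d : 0 < d -> hausdorff_delta s d K = 0%E.
  move=> d0; apply/eqP; rewrite eq_le hausdorff_delta_ge0 andbT.
  apply/lee_addgt0Pr => e e0; rewrite add0e.
  pose P : R := (4 * M) `^ s.
  have P0 : 0 < P by rewrite powR_gt0// mulr_gt0.
  (* The first term brings the total cost below [e], the second brings the diameters below [d]. *)
  pose X : R := Num.max ((P / e) `^ ((s - 2)^-1)) (4 * M / d).
  pose N : nat := (Num.truncn X).+1.
  have XN : X <= N%:R by apply/ltW; exact: truncnS_gt.
  have N0 : (0 : R) < N%:R by rewrite ltr0n.
  have [N1 N2] : (P / e) `^ ((s - 2)^-1) <= N%:R /\ 4 * M / d <= N%:R.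
    by move: XN; rewrite /X ge_max => /andP[].
  pose h : R := 2 * M / N%:R.
  have h0 : 0 < h by rewrite divr_gt0// mulr_gt0.
  have hN : h * N%:R = 2 * M by rewrite /h divfK// gt_eqF.
  pose Q (k : nat) (t : R) := k%:R * h - M <= t <= (k%:R + 1) * h - M.
  (* Quotient and remainder by [N] number the cells; from [N * N] on the sets are empty and cost
     0. *)
  pose U i : set (R * R) :=
    if (i < N * N)%N then [set x | Q (i %/ N)%N x.1 /\ Q (i %% N)%N x.2] else set0.
  have hd : 2 * h <= d.
    by move: N2; rewrite ler_pdivrMr// /h => ?; rewrite mulrA ler_pdivrMr//; lra.
  have diamU i : (ediam (U i) <= (2 * h)%:E)%E.
    apply: ge_ereal_sup => _ [x [y [Ux [Uy ->]]]]; rewrite lee_fin.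
    apply: (le_trans (eucl_le_norm _ _)); rewrite ler_pM2l//.
    move: Ux Uy; rewrite /U; case: ifP => // _ [/andP[? ?] /andP[? ?]] [/andP[? ?] /andP[? ?]].
    rewrite plane_norm_le /= !ler_norml.
    by apply/andP; split; apply/andP; split; lra.
  have costU i : (hcost s (U i) <= ((2 * h) `^ s)%:E)%E.
    rewrite /hcost; case: pselect => [?|Un]; first by rewrite lee_fin powR_ge0.
    have [x Ux] : U i !=set0 by apply/set0P/eqP.
    have /andP[l1 l2] := eucl_le_ediam (diamU i) Ux Ux.
    have l0 : 0 <= fine (ediam (U i)) by apply: le_trans l1; exact: eucl_ge0.
    by rewrite lee_fin; apply: ge0_ler_powR; rewrite ?nnegrE//; lra.
  have cell t : `|t| < M -> exists2 k, (k < N)%N & Q k t.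
    rewrite ltr_norml => /andP[t1 t2].
    have z0 : 0 <= (t + M) / h by rewrite divr_ge0 ?(ltW h0)//; lra.
    exists (Num.truncn ((t + M) / h)).
      by rewrite truncn_lt_nat// ltr_pdivrMr// mulrC hN; lra.
    have /andP[] := truncn_itv z0; rewrite -natr1 ler_pdivlMr// ltr_pdivrMr// => ? ?.
    by apply/andP; split; lra.
  apply: ge_ereal_inf; exists (\sum_(i <oo) hcost s (U i))%E.
    exists U => //; split; last first.
      by move=> i; apply: (le_trans (diamU i)); rewrite lee_fin.
    move=> x Kx; have := KM x Kx; rewrite plane_norm_lt => /andP[x1 x2].
    have [k kN Qk] := cell _ x1; have [l lN Ql] := cell _ x2.
    exists (k * N + l)%N => //; rewrite /U ifT.
      by rewrite /= divnMDl// modnMDl divn_small// modn_small// addn0.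
    by apply: (@leq_trans (k * N + N)); [rewrite ltn_add2l|rewrite -mulSnr leq_mul2r kN orbT].
  have bound : (N * N)%:R * (2 * h) `^ s <= e.
    have -> : 2 * h = 4 * M * N%:R^-1 by rewrite /h; field; rewrite gt_eqF.
    rewrite powRM ?invr_ge0 ?(ltW N0)//; last by rewrite mulr_ge0// ltW.
    rewrite -/P -powR_inv1 ?(ltW N0)// -powRrM mulN1r.
    have NN : (N * N)%:R = N%:R `^ 2 :> R by rewrite powR_mulrn ?(ltW N0)// natrM expr2.
    rewrite NN mulrCA -powRD; last by rewrite (gt_eqF N0) implybT.
    have NS : P / e <= N%:R `^ (s - 2).
      have sp : 0 < s - 2 by lra.
      have -> : P / e = ((P / e) `^ ((s - 2)^-1)) `^ (s - 2).
        by rewrite -powRrM mulVf ?gt_eqF// powRr1// divr_ge0// ltW.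
      by apply: ge0_ler_powR; rewrite ?nnegrE ?powR_ge0// ltW.
    have -> : 2 - s = - (s - 2) by ring.
    rewrite powRN ler_pdivrMr ?powR_gt0//.
    by move: NS; rewrite ler_pdivrMr//; lra.
  apply: nneseries_le => [i|n]; first exact: hcost_ge0.
  apply: (@le_trans _ _ (\sum_(0 <= i < n) (if (i < N * N)%N then ((2 * h) `^ s)%:E else 0))%E).
    apply: lee_sum => i _; case: ifPn => // iN.
    by rewrite /hcost /U (negbTE iN); case: pselect.
  apply: (@le_trans _ _ ((N * N)%:R * (2 * h) `^ s)%:E); last by rewrite lee_fin.
  have c0 : 0 <= (2 * h) `^ s by exact: powR_ge0.
  have cnt : (\sum_(0 <= i < n) (if (i < N * N)%N then ((2 * h) `^ s)%:E else 0) =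
      ((minn n (N * N))%:R * (2 * h) `^ s)%:E)%E.
    elim: n => [|n IH]; first by rewrite big_geq// min0n mul0r.
    rewrite big_nat_recr//= IH; case: (boolP (n < N * N)%N) => nN.
      by rewrite (minn_idPl nN) (minn_idPl (ltnW nN)) -EFinD -(natr1 n); congr EFin; ring.
    rewrite -leqNgt in nN.
    by rewrite adde0 (minn_idPr nN) (minn_idPr (leqW nN)).
  by rewrite cnt lee_fin ler_wpM2r// ler_nat geq_minr.
apply/eqP; rewrite eq_le; apply/andP; split.
  by apply: ge_ereal_sup => _ [d /= d0 <-]; rewrite main.
apply: (@le_trans _ _ (hausdorff_delta s 1 K)); first by rewrite main.
by apply: ereal_sup_ubound; exists 1 => /=; rewrite ?ltr01.
Qed.

Lemma hdim_eq2 K (M : R) : 0 < M -> (forall x, K x -> `|x| < M) ->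
  (forall s, 0 <= s -> s < 2 -> hausdorff s K <> 0%E) -> hdim K = 2%:E.
Proof.
move=> M0 KM low; apply/eqP; rewrite eq_le; apply/andP; split; last first.
  apply: le_ereal_inf_tmp => _ [s [s0 hs] <-]; rewrite lee_fin leNgt; apply/negP => s2.
  exact: low hs.
apply/lee_addgt0Pr => e e0; apply: ereal_inf_lbound; exists (2 + e) => //.
by split; [lra|apply: (hausdorff_bounded M0) => //; lra].
Qed.

End hausdorff.

(** * The chain rule along trajectories *)

Section space_time.
Variable R : realType.
Implicit Types (phi : R * (R * R) -> R) (p : R * (R * R)) (k : R * R).

Definition axis0 : R * (R * R) := (1, (0, 0)).
Definition axis1 : R * (R * R) := (0, (1, 0)).
Definition axis2 : R * (R * R) := (0, (0, 1)).

(** [test_fun] provides directional derivatives only, so differentiability is derived: change one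
    coordinate at a time, use the mean value theorem on each segment and continuity of the partial
    derivatives, with [e / 3] for each. *)
Lemma first_order phi p0 : test_fun phi -> forall e, 0 < e -> exists2 d, 0 < d &
  forall p, `|p - p0| < d ->
   `|phi p - phi p0 - ((p - p0).1 * 'D_axis0 phi p0 + (p - p0).2.1 * 'D_axis1 phi p0
      + (p - p0).2.2 * 'D_axis2 phi p0)| <= e * `|p - p0|.
Proof.
move=> tp e e0; have e3 : 0 < e / 3 by lra.
have near_d v : exists2 d, 0 < d & forall p, `|p - p0| < d ->
    `|'D_v phi p - 'D_v phi p0| <= e / 3.
  have /cvgrPdist_le/(_ _ e3) := @test_fun_continuous_derive R _ phi v tp p0.
  move=> /nbhs_ballP[d /= d0 hd]; exists d => // p pd.
  rewrite distrC; apply: hd; rewrite prod_norm_ball /ball_ /= distrC.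
  exact: pd.
have [d0 d00 h0] := near_d axis0; have [d1 d10 h1] := near_d axis1; have [d2 d20 h2] := near_d axis2.
exists (Num.min d0 (Num.min d1 d2)); first by rewrite !lt_min d00 d10 d20.
case: p0 {near_d} h0 h1 h2 => [t [a b]] h0 h1 h2 [t' [a' b']].
rewrite !lt_min => /and3P[pd0 pd1 pd2].
set r := `|_| in pd0 pd1 pd2 *.
have rE : r = Num.max `|t' - t| (Num.max `|a' - a| `|b' - b|) by rewrite /r !prod_normE.
have [rt [ra rb]] : `|t' - t| <= r /\ `|a' - a| <= r /\ `|b' - b| <= r.
  by rewrite rE !le_max !lexx !orbT.
have dist (x y z : R) : `|x - t| <= r -> `|y - a| <= r -> `|z - b| <= r ->
    `|(x, (y, z)) - (t, (a, b)) : R * (R * R)| <= r.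
  by move=> ? ? ?; rewrite !prod_normE /= !ge_max; apply/andP; split => //; apply/andP.
have btw (x y z c : R) : Num.min x y <= z <= Num.max x y -> `|y - x| <= c -> `|z - x| <= c.
  move=> hz; rewrite !ler_norml => /andP[? ?]; move: hz.
  by case: (lerP x y) => ? /andP[? ?]; apply/andP; split; lra.
have r0 : 0 <= r by exact: normr_ge0.
have l0 (y z s : R) : s *: axis0 + (0, (y, z)) = (s, (y, z)).
  by rewrite /axis0; congr (_, (_, _)); rewrite /= /GRing.scale /= ?mulr1 ?mulr0 ?addr0 ?add0r.
have l1 (x z s : R) : s *: axis1 + (x, (0, z)) = (x, (s, z)).
  by rewrite /axis1; congr (_, (_, _)); rewrite /= /GRing.scale /= ?mulr1 ?mulr0 ?addr0 ?add0r.
have l2 (x y s : R) : s *: axis2 + (x, (y, 0)) = (x, (y, s)).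
  by rewrite /axis2; congr (_, (_, _)); rewrite /= /GRing.scale /= ?mulr1 ?mulr0 ?addr0 ?add0r.
have dv v p := @test_fun_derivable R _ phi v p tp.
have [x0 b0 m0] := @mvt_line R _ phi axis0 (0, (a', b')) t t' (dv axis0).
have [x1 b1 m1] := @mvt_line R _ phi axis1 (t, (0, b')) a a' (dv axis1).
have [x2 b2 m2] := @mvt_line R _ phi axis2 (t, (a, 0)) b b' (dv axis2).
rewrite !l0 in m0; rewrite !l1 in m1; rewrite !l2 in m2.
have n0 : `|'D_axis0 phi (x0, (a', b')) - 'D_axis0 phi (t, (a, b))| <= e / 3.
  by apply: h0; apply: le_lt_trans pd0; apply: dist => //; exact: btw b0 rt.
have n1 : `|'D_axis1 phi (t, (x1, b')) - 'D_axis1 phi (t, (a, b))| <= e / 3.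
  by apply: h1; apply: le_lt_trans pd1; apply: dist => //; [rewrite subrr normr0|exact: btw b1 ra].
have n2 : `|'D_axis2 phi (t, (a, x2)) - 'D_axis2 phi (t, (a, b))| <= e / 3.
  by apply: h2; apply: le_lt_trans pd2; apply: dist; [rewrite subrr normr0|rewrite subrr normr0|exact: btw b2 rb].
move: n0 n1 n2 m0 m1 m2; rewrite /=.
set D0' := 'D_axis0 phi (t, (a, b)); set D1' := 'D_axis1 phi (t, (a, b)); set D2' := 'D_axis2 phi (t, (a, b)).
set D0 := 'D_axis0 phi _; set D1 := 'D_axis1 phi _; set D2 := 'D_axis2 phi _ => n0 n1 n2 m0 m1 m2.
have -> : phi (t', (a', b')) - phi (t, (a, b)) - ((t' - t) * D0' + (a' - a) * D1' + (b' - b) * D2')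
  = (t' - t) * (D0 - D0') + (a' - a) * (D1 - D1') + (b' - b) * (D2 - D2').
  have -> : phi (t', (a', b')) - phi (t, (a, b)) = (phi (t', (a', b')) - phi (t, (a', b')))
    + (phi (t, (a', b')) - phi (t, (a, b'))) + (phi (t, (a, b')) - phi (t, (a, b))) by ring.
  by rewrite m0 m1 m2; ring.
have one (x y : R) : `|x| <= r -> `|y| <= e / 3 -> `|x * y| <= r * (e / 3).
  by move=> ? ?; rewrite normrM; apply: ler_pM.
have -> : e * r = r * (e / 3) + r * (e / 3) + r * (e / 3) by move: (r) (e) => u v; field.
apply: (le_trans (ler_normD _ _)); apply: lerD; last exact: (one _ _ rb n2).
apply: (le_trans (ler_normD _ _)).
by apply: lerD; [exact: (one _ _ rt n0)|exact: (one _ _ ra n1)].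
Qed.

(** When [U k = k], the velocity at [lam t *: k] is [dlam t *: k], so this derivative is the
    integrand of weak advection evaluated on the trajectory. *)
Lemma is_derive_trajectory phi k (t : R) : test_fun phi ->
  is_derive t 1 (fun s : R => phi (s, lam s *: k))
    ('D_axis0 phi (t, lam t *: k) + dlam t * (k.1 * 'D_axis1 phi (t, lam t *: k)
       + k.2 * 'D_axis2 phi (t, lam t *: k))).
Proof.
move=> tp; apply: is_derive_eps => e e0.
set p0 := (t, lam t *: k).
(* [L] bounds the speed of the space-time curve, as [lam] is 2-Lipschitz. *)
pose L : R := 1 + 2 * `|k|.
have L0 : 1 <= L by rewrite /L; have := normr_ge0 k; lra.
pose M : R := `|k.1 * 'D_axis1 phi p0 + k.2 * 'D_axis2 phi p0|.
have M0 : 0 <= M by exact: normr_ge0.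
have eL : 0 < e / (2 * L) by rewrite divr_gt0//; lra.
(* Half of [e] pays for the first-order error of [phi], the other half for the remainder [8 h^2 M]
   coming from [lam]; hence 16. *)
have eM : 0 < e / (16 * (M + 1)) by rewrite divr_gt0//; lra.
have [d d0 hd] := first_order p0 tp eL.
exists (Num.min (d / L) (e / (16 * (M + 1)))); first by rewrite lt_min eM divr_gt0//; lra.
move=> h; rewrite lt_min => /andP[hL hM].
have L1 : 0 < L by lra.
have M1 : 0 < 16 * (M + 1) by lra.
rewrite ltr_pdivlMr// in hL; rewrite ltr_pdivlMr// in hM.
set p := (t + h, lam (t + h) *: k).
have pp : p - p0 = (h, (lam (t + h) - lam t) *: k).
  have -> : p - p0 = (t + h - t, lam (t + h) *: k - lam t *: k) by [].
  by rewrite (addrC t) addrK -scalerBl.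
have np : `|p - p0| <= L * `|h|.
  rewrite pp prod_normE /= ge_max; apply/andP; split.
    by have := normr_ge0 h; nra.
  rewrite prod_norm_scale; have := @lam_lip R (t + h) t; have -> : t + h - t = h by ring.
  by have := normr_ge0 k; have := normr_ge0 h; rewrite /L; nra.
have := hd p; rewrite pp /= => /(_ (le_lt_trans _ _)) H1.
have {H1} : `|phi p - phi p0 - (h * 'D_axis0 phi p0 + (lam (t + h) - lam t) *: k.1 * 'D_axis1 phi p0
    + (lam (t + h) - lam t) *: k.2 * 'D_axis2 phi p0)| <= e / (2 * L) * (L * `|h|).
  have np' := np; rewrite pp in np'.
  apply: le_trans (H1 _ np' _) _; last by rewrite ler_wpM2l// ltW.
  by rewrite mulrC.
rewrite /GRing.scale /=.
have -> : e / (2 * L) * (L * `|h|) = e / 2 * `|h| by field; lra.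
have q := lam_quadratic t h.
have hh : h ^+ 2 = `|h| * `|h| by rewrite -normrM -expr2 ger0_norm ?sqr_ge0.
have alg (A c X dl k1 Y1 k2 Y2 D : R) : A - c * (X + dl * (k1 * Y1 + k2 * Y2)) =
  (A - (c * X + D * k1 * Y1 + D * k2 * Y2)) + (D - c * dl) * (k1 * Y1 + k2 * Y2) by ring.
rewrite (alg _ _ _ _ _ _ _ _ (lam (t + h) - lam t)).
have half : e * `|h| = e / 2 * `|h| + e / 2 * `|h| by move: `|h| (e) => u v; field.
rewrite half.
move=> r1; apply: (le_trans (ler_normD _ _)); apply: (lerD r1).
have r2 : `|(lam (t + h) - lam t - h * dlam t) * (k.1 * 'D_axis1 phi p0 + k.2 * 'D_axis2 phi p0)|
    <= 8 * h ^+ 2 * M by rewrite normrM ler_wpM2r.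
rewrite hh in r2; have := normr_ge0 h => h0.
have r3 : 8 * (`|h| * `|h|) * M <= e / 2 * `|h|.
  have : `|h| * (`|h| * (16 * (M + 1))) <= `|h| * e by rewrite ler_wpM2l// ltW.
  by move: (M) M0 `|h| (e) h0 e0 => m m0 u v u0 v0; have := mulr_ge0 u0 u0; nra.
exact: le_trans r2 r3.
Qed.

End space_time.

(** * Atomic measures, and exchange of time integral and sum *)

Section atomic_measure.
Variable R : realType.
Implicit Types (k : nat -> R * R) (f : R * R -> R).

(* Any probability on nat that charges every point would do. *)
Definition weights : probability nat R := poisson_prob (1 : R) 0.

Lemma weights_gt0 j : (0 < weights [set j])%E.
Proof.
rewrite /weights /= /poisson_prob ltr01 esum_set1; last by rewrite lee_fin poisson_pmf_ge0.
by rewrite lte_fin /poisson_pmf ltr01 expr1n mul1r mulr_gt0 ?expR_gt0// invr_gt0 ltr0n fact_gt0.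
Qed.

Lemma weights_lty : (weights setT < +oo)%E.
Proof. by rewrite probability_setT ltry. Qed.

(** Encoding the sum of Dirac masses as an image measure turns integrals against it into integrals
    over nat, where Fubini applies. *)
Definition atomic k : {measure set (R * R) -> \bar R}.
Proof. by refine (pushforward weights k). Defined.

Lemma atomicE k A : atomic k A = weights (k @^-1` A).
Proof. by []. Qed.

Lemma bounded_integrable_weights (g : nat -> R) (C : R) : (forall j, `|g j| <= C) ->
  weights.-integrable setT (EFin \o g).
Proof.
move=> gC; apply: measurable_bounded_integrable => //.
  exact: weights_lty.
exists C; split; first exact: num_real.
by move=> D CD j _; apply: le_trans (gC j) (ltW CD).
Qed.

Lemma integral_atomic k f (C : R) : continuous f -> (forall j, `|f (k j)| <= C) ->
  (\int[atomic k]_x (f x)%:E = \int[weights]_j (f (k j))%:E)%E.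
Proof.
move=> cf fC.
rewrite (@integral_pushforward _ _ _ _ _ k _ weights setT (EFin \o f)) ?preimage_setT//.
  by apply/measurable_EFinP; exact: plane_continuous_measurable.
exact: (bounded_integrable_weights fC).
Qed.

Lemma integral_time_weights (F : R -> nat -> R) (T C : R) :
  (forall j, continuous (F ^~ j)) -> (forall t j, 0 <= t <= T -> `|F t j| <= C) ->
  (\int[lebesgue_measure]_(t in `[0%R, T]) \int[weights]_j (F t j)%:E =
   \int[weights]_j \int[lebesgue_measure]_(t in `[0%R, T]) (F t j)%:E)%E /\
  weights.-integrable setT (fun j => \int[lebesgue_measure]_(t in `[0%R, T]) (F t j)%:E)%E.
Proof.
move=> cF FC.
pose D : set R := `[0%R, T].
pose f (x : nat * R) : \bar R := ((EFin \o (fun x : nat * R => F x.2 x.1)) \_ (setT `*` D)) x.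
have mD : measurable D by exact: measurable_itv.
(* Joint measurability follows from that of the countably many time sections. *)
have mF : measurable_fun setT (fun x : nat * R => F x.2 x.1).
  move=> _ Y mY; rewrite setTI.
  have -> : (fun x : nat * R => F x.2 x.1) @^-1` Y =
      \bigcup_j ([set j] `*` (F ^~ j) @^-1` Y).
    by apply/seteqP; split => [[j t] /= h|[j t] [i _ [/= -> h]]//]; exists j.
  apply: bigcup_measurable => j _; apply: measurableX => //.
  rewrite -[X in measurable X]setTI.
  exact: (continuous_measurable_fun (cF j)).
have lD : (@lebesgue_measure R D < +oo)%E.
  by rewrite lebesgue_measure_itv/=; case: ifP => _; rewrite -?EFinD ltry.
have intf : (weights \x (@lebesgue_measure R))%E.-integrable setT f.
  apply/integrable_restrict => //; first exact: measurableX.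
  rewrite setTI; apply: measurable_bounded_integrable => //.
  - exact: measurableX.
  - have e := product_measure1E weights (@lebesgue_measure R) (measurableT : measurable [set: nat]) mD.
    by rewrite [ltLHS]e lte_mul_pinfty// ge0_fin_numE// weights_lty.
  - exact: measurable_funTS.
  - exists C; split; first exact: num_real.
    move=> c Cc [j t] [/= _ Dt]; apply: le_trans (ltW Cc); apply: FC.
    by move: Dt; rewrite /D /= in_itv.
have sec j : (\int[lebesgue_measure]_t f (j, t) =
    \int[lebesgue_measure]_(t in `[0%R, T]) (F t j)%:E)%E.
  rewrite [RHS]integral_mkcond; apply: eq_integral => t _; rewrite /f !patchE.
  by rewrite in_setX /= in_setT.
split; last first.
  have := integrable_fubini_F intf; congr (_.-integrable _ _).
  by apply/funext => j; exact: sec.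
have := Fubini intf => h; rewrite (eq_integral _ _ (fun j _ => esym (sec j))) h.
rewrite integral_mkcond; apply: eq_integral => t _; rewrite patchE /f.
case: ifPn => h'; last first.
  by rewrite integral0_eq// => j _; rewrite patchE in_setX /= (negbTE h') andbF.
by apply: eq_integral => j _; rewrite patchE in_setX /= h' in_setT.
Qed.

End atomic_measure.

Lemma continuous_space_time_bounded (R : realType) (f : R * (R * R) -> R) (T : R) :
  continuous f -> exists K, forall t x, 0 <= t <= T -> `|x| <= 2 -> `|f (t, x)| <= K.
Proof.
move=> cf; pose B : set (R * (R * R)) := `[0, T] `*` (`[- 2, 2] `*` `[- 2, 2]).
have cs (c d : R) : compact (`[c, d] : set R) by exact: segment_compact.
have cb : compact B := compact_setX (cs 0 T) (compact_setX (cs (- 2) 2) (cs (- 2) 2)).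
have /compact_bounded[M [_ hM]] : compact (f @` B).
  by apply: continuous_compact => //; exact: continuous_subspaceT.
exists (M + 1) => t x tT; rewrite plane_norm_le => /andP[].
rewrite (ler_norml x.1) (ler_norml x.2) => x1 x2.
have M1 : M < M + 1 by rewrite ltrDl.
have := hM _ M1; rewrite /globally /= => h; apply: h.
by exists (t, x); rewrite /B /= ?in_itv.
Qed.

(** * Weak advection of the moving atoms *)

Section advection.
Variables (R : realType) (U : R * R -> R * R) (k : nat -> R * R).
Hypothesis cvel : forall t, continuous (velocity U t).
Hypothesis Uk : forall j, U (k j) = k j.
Hypothesis k2 : forall j, `|k j| <= 2.

Lemma velocity_trajectory (t : R) j : velocity U t (lam t *: k j) = dlam t *: k j.
Proof.
rewrite /velocity; have [t0|t0] := lerP t 0; first by rewrite dlam_le0// !scale0r.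
by rewrite scalerA mulVf ?scale1r ?Uk// gt_eqF// lam_gt0.
Qed.

Lemma norm_trajectory (t : R) j : `|lam t *: k j| <= 2.
Proof.
rewrite prod_norm_scale ger0_norm ?lam_ge0//.
by have := k2 j; have := lam_le1 t; have := lam_ge0 t; have := normr_ge0 (k j); nra.
Qed.

Let continuous_slice (f : R * (R * R) -> R) (t : R) : continuous f ->
  continuous (fun x : R * R => f (t, x)).
Proof.
move=> cf; apply: (continuous_after _ cf).
by apply: continuous_pair => x; [exact: cvg_cst|exact: cvg_id].
Qed.

Let continuous_along (f : R * (R * R) -> R) j : continuous f ->
  continuous (fun t : R => f (t, lam t *: k j)).
Proof.
move=> cf; apply: (continuous_after _ cf).
have cl : continuous (@lam R) by apply: is_derive_continuous; exact: is_derive_lam.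
apply: continuous_pair; first by move=> x; exact: cvg_id.
have -> : (fun t => lam t *: k j) = (fun t => (lam t * (k j).1, lam t * (k j).2)).
  by apply/funext.
by apply: continuous_pair; apply: continuous_mul => // x; exact: cvg_cst.
Qed.

(** For each atom the identity is the fundamental theorem of calculus along its trajectory;
    averaging over [j] and Fubini give the claim, all integrands being bounded since the atoms stay
    in [|x| <= 2]. *)
Lemma weakly_advected_atomic (T : R) : 0 < T ->
  weakly_advected (velocity U) (fun t => atomic (fun j => lam t *: k j)) T.
Proof.
move=> T0 phi tp.
have -> : [set t : R | (0 <= t <= T)%R] = `[0, T]%classic by rewrite set_itvcc.
pose D0 := 'D_(@axis0 R) phi; pose D1 := 'D_(@axis1 R) phi; pose D2 := 'D_(@axis2 R) phi.
have cD0 : continuous D0 by exact: test_fun_continuous_derive.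
have cD1 : continuous D1 by exact: test_fun_continuous_derive.
have cD2 : continuous D2 by exact: test_fun_continuous_derive.
have cphi := test_fun_continuous tp.
have [K0 hK0] := continuous_space_time_bounded T cD0.
have [K1 hK1] := continuous_space_time_bounded T cD1.
have [K2 hK2] := continuous_space_time_bounded T cD2.
have [Kp hKp] := continuous_space_time_bounded T cphi.
pose F1 (t : R) j := D0 (t, lam t *: k j).
pose F2 (t : R) j := dlam t * ((k j).1 * D1 (t, lam t *: k j) + (k j).2 * D2 (t, lam t *: k j)).
have cdlam : continuous (@dlam R).
  by apply: (@continuous_lipschitz R _ 16); exact: dlam_lip.
have cF1 j : continuous (F1 ^~ j) := @continuous_along _ j cD0.
have ccst (c : R) : continuous (fun _ : R => c) by move=> x; exact: cvg_cst.
have cF2 j : continuous (F2 ^~ j) := continuous_mul cdlam (continuous_add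
  (continuous_mul (ccst (k j).1) (@continuous_along _ j cD1))
  (continuous_mul (ccst (k j).2) (@continuous_along _ j cD2))).
have bF1 t j : 0 <= t <= T -> `|F1 t j| <= K0.
  by move=> tT; apply: hK0 => //; exact: norm_trajectory.
have one (x y B : R) : `|x| <= 2 -> `|y| <= B -> `|x * y| <= 2 * B.
  by move=> hx hy; rewrite normrM; apply: ler_pM.
have bF2 t j : 0 <= t <= T -> `|F2 t j| <= 2 * (2 * K1 + 2 * K2).
  move=> tT; have nt := norm_trajectory t j.
  have n1 := one _ _ _ (le_trans (plane_coord1 _) (k2 j)) (hK1 t _ tT nt).
  have n2 := one _ _ _ (le_trans (plane_coord2 _) (k2 j)) (hK2 t _ tT nt).
  have n0 : `|dlam t| <= 2 by rewrite ger0_norm ?dlam_ge0 ?dlam_le2.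
  exact: (one _ _ _ n0 (le_trans (ler_normD _ _) (lerD n1 n2))).
have [s1 i1] := integral_time_weights cF1 bF1.
have [s2 i2] := integral_time_weights cF2 bF2.
have inner1 : (\int[lebesgue_measure]_(t in `[0%R, T])
    (\int[atomic (fun j => lam t *: k j)]_x (D0 (t, x))%:E) =
    \int[lebesgue_measure]_(t in `[0%R, T]) \int[weights R]_j (F1 t j)%:E)%E.
  apply: eq_integral => t; rewrite inE /= in_itv /= => tT.
  apply: (@integral_atomic R _ (fun x => D0 (t, x)) K0); first exact: (@continuous_slice _ t cD0).
  by move=> j; exact: bF1.
have inner2 : (\int[lebesgue_measure]_(t in `[0%R, T])
    (\int[atomic (fun j => lam t *: k j)]_x ((velocity U t x).1 * D1 (t, x)
       + (velocity U t x).2 * D2 (t, x))%:E) =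
    \int[lebesgue_measure]_(t in `[0%R, T]) \int[weights R]_j (F2 t j)%:E)%E.
  apply: eq_integral => t; rewrite inE /= in_itv /= => tT.
  have e j : (velocity U t (lam t *: k j)).1 * D1 (t, lam t *: k j)
       + (velocity U t (lam t *: k j)).2 * D2 (t, lam t *: k j) = F2 t j.
    by rewrite velocity_trajectory /F2 /= /GRing.scale /= -!mulrA -mulrDr.
  have c1 : continuous (fun x => (velocity U t x).1 : R).
    by move=> x; apply: continuous_comp; [exact: cvel|exact: cvg_fst].
  have c2 : continuous (fun x => (velocity U t x).2 : R).
    by move=> x; apply: continuous_comp; [exact: cvel|exact: cvg_snd].
  have cf := continuous_add (continuous_mul c1 (@continuous_slice _ t cD1))
      (continuous_mul c2 (@continuous_slice _ t cD2)).
  rewrite (@integral_atomic R _ _ (2 * (2 * K1 + 2 * K2)) cf); last first.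
    by move=> j; rewrite e; exact: bF2.
  by apply: eq_integral => j _; rewrite e.
have T0T : 0 <= T <= T by rewrite lexx ltW.
have O0T : (0 : R) <= 0 <= T by rewrite lexx ltW.
pose a j := phi (T, lam T *: k j); pose b j := phi (0, lam 0 *: k j).
have ba j : `|a j| <= Kp by apply: hKp => //; exact: norm_trajectory.
have bb j : `|b j| <= Kp by apply: hKp => //; exact: norm_trajectory.
have endT : (\int[atomic (fun j => lam T *: k j)]_x (phi (T, x))%:E = \int[weights R]_j (a j)%:E)%E.
  by apply: (@integral_atomic R _ (fun x => phi (T, x)) Kp) => //; exact: (@continuous_slice _ T cphi).
have end0 : (\int[atomic (fun j => lam 0 *: k j)]_x (phi (0%R, x))%:E = \int[weights R]_j (b j)%:E)%E.
  by apply: (@integral_atomic R _ (fun x => phi (0, x)) Kp) => //; exact: (@continuous_slice _ 0 cphi).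
have step j : (\int[lebesgue_measure]_(t in `[0%R, T]) (F1 t j)%:E +
    \int[lebesgue_measure]_(t in `[0%R, T]) (F2 t j)%:E = (a j)%:E - (b j)%:E)%E.
  have cint (F : R -> R) : continuous F ->
      (@lebesgue_measure R).-integrable `[0, T] (EFin \o F).
    move=> cF; apply: continuous_compact_integrable; first exact: segment_compact.
    exact: continuous_subspaceT.
  have e mD := integralD_EFin mD (cint _ (cF1 j)) (cint _ (cF2 j)).
  rewrite -EFinB; apply: (etrans (esym (e _))); first exact: measurable_itv.
  exact: (integral_is_derive T0 (fun t => is_derive_trajectory (k j) t tp) (continuous_add (cF1 j) (cF2 j))).
have ia := bounded_integrable_weights ba; have ib := bounded_integrable_weights bb.
have sum12 : (\int[weights R]_j \int[lebesgue_measure]_(t in `[0%R, T]) (F1 t j)%:E +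
   \int[weights R]_j \int[lebesgue_measure]_(t in `[0%R, T]) (F2 t j)%:E =
   \int[weights R]_j (a j)%:E - \int[weights R]_j (b j)%:E)%E.
  rewrite -integralB_EFin// -integralD//.
  by apply: eq_integral => j _; exact: step.
have f1 := integrable_fin_num measurableT i1; have f2 := integrable_fin_num measurableT i2.
have fa := integrable_fin_num measurableT ia; have fb := integrable_fin_num measurableT ib.
(* The terms can be moved across the equation in the extended reals only because all four are
   finite. *)
have fin (x y z w : \bar R) : x \is a fin_num -> y \is a fin_num -> z \is a fin_num ->
    w \is a fin_num -> (x + y = z - w -> x - z + w + y = 0)%E.
  move=> /fineK<- /fineK<- /fineK<- /fineK<-; rewrite -!EFinB -!EFinD => -[h].
  by congr EFin; lra.
apply: (etrans _ (fin _ _ _ _ f1 f2 fa fb sum12)).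
by rewrite -s1 -s2 -inner1 -inner2 -endT -end0.
Qed.

End advection.

(** * Supports of atomic measures *)

Section support.
Variables (R : realType) (k : nat -> R * R).

Lemma plane_ballE (x y : R * R) (r : R) : ball x r y = (`|x - y| < r).
Proof. by rewrite prod_norm_ball. Qed.

Lemma atomic_ball_gt0 (x : R * R) (r : R) j : `|x - k j| < r -> (0 < atomic k (ball x r))%E.
Proof.
move=> h; apply: (lt_le_trans (weights_gt0 R j)).
rewrite atomicE; apply: le_measure; rewrite ?inE//.
by move=> i ->; rewrite /= plane_ballE.
Qed.

Lemma atomic_ball_eq0 (x : R * R) (r : R) :
  (forall j, r <= `|x - k j|) -> atomic k (ball x r) = 0%E.
Proof.
move=> h; rewrite atomicE (_ : _ @^-1` _ = set0) ?measure0//.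
by apply/seteqP; split => // j; rewrite /= plane_ballE ltNge h.
Qed.

Lemma atomic_locally_finite : locally_finite (atomic k).
Proof.
move=> x; exists 1 => //; rewrite atomicE.
by apply: (le_lt_trans _ (weights_lty R)); apply: le_measure; rewrite ?inE.
Qed.

End support.

(** * Assembly of the field and the measure *)

Unset Implicit Arguments.

Theorem theorem2 (R : realType) :
  exists (u : R -> R * R -> R * R) (omega : R -> {measure set (R * R) -> \bar R}),
    (* u uniformly continuous on [0,oo) x R^2 *)
    (forall e : R, 0 < e -> exists2 d : R, 0 < d &
       forall (t s : R) (x y : R * R), 0 <= t -> 0 <= s ->
         `|t - s| < d -> eucl x y < d -> eucl (u t x) (u s y) < e) /\
    (* u compactly supported in [0,oo) x R^2 *)
    (exists M : R, forall (t : R) (x : R * R), 0 <= t ->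
       (M < t \/ M < enorm x) -> u t x = (0, 0)) /\
    weakly_div_free u /\
    (* omega(t) locally finite Borel measures *)
    (forall t : R, 0 <= t -> locally_finite (omega t)) /\
    (forall T : R, 0 < T -> weakly_advected u omega T) /\
    msupp (omega 0) = [set (0, 0)] /\
    (forall t : R, 0 < t -> hdim (msupp (omega t)) = 2%:E) /\
    (* u locally Lipschitz on [0,oo) x (R^2 \ {0}) *)
    (forall (t : R) (x : R * R), 0 <= t -> x <> (0, 0) ->
       exists2 r : R, 0 < r & exists L : R,
         forall (s s' : R) (y y' : R * R), 0 <= s -> 0 <= s' ->
           `|s - t| < r -> `|s' - t| < r -> eucl y x < r -> eucl y' x < r ->
           eucl (u s y) (u s' y') <= L * (`|s - s'| + eucl y y')).
Proof.
(* Target dimensions: they tend to 2 from below, and are at least 1 as [ratio_of_dimension]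
   requires. *)
pose a (n : nat) : R := 2 - n.+1%:R^-1.
have i0 n : 0 < (n.+1%:R^-1 : R) by rewrite invr_gt0.
have a1 n : 1 <= a n.
  have : (n.+1%:R^-1 : R) <= 1 by rewrite invf_le1// ler1n.
  by rewrite /a; move: (_^-1) => z ?; lra.
have a2 n : a n < 2 by have := i0 n; rewrite /a; move: (_^-1) => z ?; lra.
have [sg hsg] := choice (fun n => ratio_of_dimension (a1 n) (a2 n)).
have hsg' n : 1/4 <= sg n /\ sg n < 1/2 by case: (hsg n).
have [U [p [kap [U_sol [C [C0 U_lin]] U_supp U_lip U_pts]]]] := multi_scale_field hsg'.
pose pt (c : nat * seq (bool * bool)) : R * R := p c.1 + kap c.1 *: word_point (sg c.1) c.2.
(* One sequence enumerates the points of all scales; indices that decode to nothing repeat the point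
   of [(0, [::])]. *)
pose k j := pt (odflt (0%N, [::]) (unpickle j)).
have kE c : k (pickle c) = pt c by rewrite /k pickleK.
have Uk j : U (k j) = k j.
  by rewrite /k /pt; set c := odflt _ _; case: (U_pts c.1).
have k2 j : `|k j| <= 2.
  rewrite /k /pt; set c := odflt _ _; have [kp pk _] := U_pts c.1.
  have [s4 sh] := hsg' c.1.
  have : `|word_point (sg c.1) c.2| <= 1 by apply: norm_word_point; lra.
  move=> h; apply: (le_trans (ler_normD _ _)); rewrite prod_norm_scale gtr0_norm//.
  by move: pk kp h (normr_ge0 (p c.1)); move: `|p _| (kap _) `|word_point _ _| => x y z ? ? ? ?; nra.
pose K (t : R) j : R * R := lam t *: k j.
have K2 t j : `|K t j| <= 2 by exact: norm_trajectory.
exists (velocity U), (fun t => atomic (K t)).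
split.
  move=> e e0; have e2 : 0 < e / 2 by lra.
  have [d d0 hd] := velocity_uniformly_continuous C0 U_lin U_supp U_lip e2.
  exists d => // t s x y _ _ ts xy; apply: (le_lt_trans (eucl_le_norm _ _)).
  by have := hd t s x y ts (le_lt_trans (norm_le_eucl _ _) xy); lra.
split.
  (* A Euclidean norm above 4 forces max norm above 2, where the velocity vanishes. *)
  exists 4 => t x _ [t4|x4]; first by rewrite /velocity dlam_ge1 ?scale0r//; lra.
  by apply: velocity_far => //; have := eucl_le_norm x 0; rewrite -enormE subr0; lra.
split; first exact: velocity_weakly_div_free.
split; first by move=> t _; exact: atomic_locally_finite.
split.
  move=> T T0; apply: weakly_advected_atomic => // t.
  exact: velocity_continuous C0 U_lin U_supp U_lip t.
split.
  apply/seteqP; split => x.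
    move=> /= h; apply/eqP; rewrite -normr_le0 leNgt; apply/negP => x0.
    have := h _ x0; rewrite atomic_ball_eq0 ?ltxx// => j.
    by rewrite /K lam_le0// scale0r subr0.
  move=> -> r r0; apply: (@atomic_ball_gt0 _ _ _ _ 0%N).
  by rewrite /K lam_le0// scale0r subr0 normr0.
split.
  move=> t t0; have l0 := lam_gt0 t0.
  (* All atoms lie in [|x| <= 2], so a ball of radius 1/2 about a point of norm at least 3 is
     null. *)
  apply: (@hdim_eq2 _ _ 3) => //.
    move=> x h; rewrite ltNge; apply/negP => x3.
    have h2 : (0 : R) < 1/2 by lra.
    have := h _ h2; rewrite atomic_ball_eq0 ?ltxx// => j.
    by have := lerB_dist x (K t j); have := K2 t j; lra.
  move=> s s0 s2.
  have [n sn] : exists n, s <= a n.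
    exists (Num.truncn (2 - s)^-1).
    have s2' : 0 < 2 - s by lra.
    have : ((Num.truncn (2 - s)^-1).+1%:R^-1 : R) <= 2 - s.
      by rewrite invf_ple ?posrE// ltW// truncnS_gt.
    by rewrite /a; move: (_%:R^-1) => z ?; lra.
  have [s4 sh sa] := hsg n.
  have an0 : 0 < a n by have := a1 n; lra.
  have [G [A [A0 Gw Gh]]] := hoelder_coding s4 sh sa an0.
  have [kp _ _] := U_pts n.
  have rho0 : 0 < lam t * kap n by exact: mulr_gt0.
  (* The support contains the moved copy of the coded Cantor points: every ball about such a point
     contains an atom, as word points approximate [G y]. *)
  apply: (hausdorff_gt0 (b := lam t *: p n) rho0 A0 s0 sn an0 _ Gh).
  move=> y _ r r0.
  have r1 : 0 < lam t * kap n + 1 by lra.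
  have [w hw] := Gw y (r / (lam t * kap n + 1)) (divr_gt0 r0 r1).
  apply: (@atomic_ball_gt0 _ _ _ _ (pickle (n, w))).
  rewrite /K kE /pt /= scalerDr scalerA opprD addrACA subrr add0r -scalerBr.
  rewrite prod_norm_scale gtr0_norm// distrC.
  move: hw; rewrite ler_pdivlMr//; have := normr_ge0 (word_point (sg n) w - G y).
  by nra.
move=> t x _ /eqP x0.
(* Points within [|x| / 2] of [x] keep max norm at least [|x| / 2], so one Lipschitz bound covers
   the neighborhood. *)
have x1 : 0 < `|x| / 2 by rewrite divr_gt0// normr_gt0.
have [L [L0 hL]] := velocity_lip C0 U_lin U_supp U_lip x1.
exists (`|x| / 2) => //; exists (2 * L) => s s' y y' _ _ _ _ yx y'x.
have far z : eucl z x < `|x| / 2 -> `|x| / 2 <= `|z|.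
  by move=> h; have := lerB_dist x (x - z); have := norm_le_eucl z x;
     rewrite opprB addrCA subrr addr0 (distrC z); lra.
apply: (le_trans (eucl_le_norm _ _)).
have := hL s s' y y' (far y yx) (far y' y'x); have := norm_le_eucl y y'.
by have := normr_ge0 (s - s'); nra.
Qed.
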